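(* Let $(G,J)$ be a simply-connected, $2$-step nilpotent Lie group equipped with a left-invariant complex structure $J$, and assume that the Lie algebra $(\mathfrak g,\mu)$ of $G$ is such that $J$ preserves the commutators, i.e. $J\mu(\mathfrak g,\mathfrak g)\subseteq\mu(\mathfrak g,\mathfrak g)$. Then, for every left-invariant Hermitian initial metric $g_0$, the flow $\partial_t g_t=-\mathrm{Ric}^{1,1}(g_t)$, $g_t|_{t=0}=g_0$, has a long-time solution, i.e. a (left-invariant) solution defined for all $t\in[0,\infty)$.
   Context: $\mathrm{Ric}^{1,1}(g)$ denotes the $J$-invariant ($(1,1)$-) component of the Riemannian Ricci tensor of the Levi-Civita connection of $g$. *)

(* Defs.v *)
From HB Require Import structures.
From mathcomp Require Import all_boot all_order all_algebra.
From mathcomp Require Import all_classical all_reals all_analysis.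
Set Implicit Arguments. Unset Strict Implicit. Unset Printing Implicit Defensive.
Import Order.TTheory GRing.Theory Num.Theory.
Import numFieldNormedType.Exports.
Local Open Scope ring_scope.

(* The Lie algebra g of G is modelled as R^m (row vectors 'rV[R]_m) with a
   bracket given by structure constants c i j = [e_i, e_j]; the bracket is
   extended bilinearly.  Endomorphisms act on the right: J x := x *m J.
   Left-invariant tensors on G = tensors on g. *)

Definition evec (R : realType) (m : nat) (i : 'I_m) : 'rV[R]_m := delta_mx 0 i.

Definition br (R : realType) (m : nat) (c : 'I_m -> 'I_m -> 'rV[R]_m)
  (x y : 'rV[R]_m) : 'rV[R]_m :=
  \sum_(i < m) \sum_(j < m) (x 0 i * y 0 j) *: c i j.

Definition lie_algebra (R : realType) (m : nat) (c : 'I_m -> 'I_m -> 'rV[R]_m) :=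
  (forall x y, br c x y = - br c y x) /\
  (forall x y z, br c x (br c y z) + br c y (br c z x) + br c z (br c x y) = 0).

Definition two_step_nilpotent (R : realType) (m : nat) (c : 'I_m -> 'I_m -> 'rV[R]_m) :=
  (forall x y z, br c (br c x y) z = 0) /\ (exists x y, br c x y != 0).

Definition complex_structure (R : realType) (m : nat) (c : 'I_m -> 'I_m -> 'rV[R]_m)
  (J : 'M[R]_m) :=
  J *m J = - 1%:M /\
  (forall x y, br c (x *m J) (y *m J) - (br c (x *m J) y) *m J
               - (br c x (y *m J)) *m J - br c x y = 0).

Definition in_derived (R : realType) (m : nat) (c : 'I_m -> 'I_m -> 'rV[R]_m)
  (v : 'rV[R]_m) :=
  exists s : seq ('rV[R]_m * 'rV[R]_m), v = \sum_(p <- s) br c p.1 p.2.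

Definition J_preserves_commutators (R : realType) (m : nat)
  (c : 'I_m -> 'I_m -> 'rV[R]_m) (J : 'M[R]_m) :=
  forall v, in_derived c v -> in_derived c (v *m J).

Definition ip (R : realType) (m : nat) (G : 'M[R]_m) (x y : 'rV[R]_m) : R :=
  (x *m G *m y^T) 0 0.

Definition is_metric (R : realType) (m : nat) (G : 'M[R]_m) :=
  G^T = G /\ (forall x : 'rV[R]_m, x != 0 -> 0 < ip G x x).

Definition hermitian_metric (R : realType) (m : nat) (J G : 'M[R]_m) :=
  is_metric G /\ (forall x y, ip G (x *m J) (y *m J) = ip G x y).

(* Koszul formula for left-invariant fields:
   2 g(nabla_x y, z) = g([x,y],z) - g([y,z],x) + g([z,x],y) *)
Definition koszul (R : realType) (m : nat) (c : 'I_m -> 'I_m -> 'rV[R]_m)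
  (G : 'M[R]_m) (x y z : 'rV[R]_m) : R :=
  (ip G (br c x y) z - ip G (br c y z) x + ip G (br c z x) y) / 2.

Definition levi_civita (R : realType) (m : nat) (c : 'I_m -> 'I_m -> 'rV[R]_m)
  (G : 'M[R]_m) (x y : 'rV[R]_m) : 'rV[R]_m :=
  (\row_k koszul c G x y (evec R k)) *m invmx G.

Definition curvature (R : realType) (m : nat) (c : 'I_m -> 'I_m -> 'rV[R]_m)
  (G : 'M[R]_m) (x y z : 'rV[R]_m) : 'rV[R]_m :=
  levi_civita c G x (levi_civita c G y z) - levi_civita c G y (levi_civita c G x z)
  - levi_civita c G (br c x y) z.

Definition ricci (R : realType) (m : nat) (c : 'I_m -> 'I_m -> 'rV[R]_m)
  (G : 'M[R]_m) (y z : 'rV[R]_m) : R :=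
  \sum_(i < m) (curvature c G (evec R i) y z) 0 i.

Definition ricci11 (R : realType) (m : nat) (c : 'I_m -> 'I_m -> 'rV[R]_m)
  (J G : 'M[R]_m) (y z : 'rV[R]_m) : R :=
  (ricci c G y z + ricci c G (y *m J) (z *m J)) / 2.

(* Main.v *)
(* On a 2-step nilpotent algebra with derived algebra V,
     Ric(y, z) = -1/2 sum_i g([y,e_i],[z,e_i])
                 + 1/4 sum_{i,j} g([e_i,e_j],y) g([e_i,e_j],z).
   Since V is central and J-stable, Ric^{1,1} is block diagonal for
   V + W, where W is the g_0-orthogonal complement of V, so W stays orthogonal
   to V along the flow.  The W-block k of the metric increases, and so does the
   inverse p of its V-block h, because h' is quadratic in h.  In the variables
   (p, k), gathered in a single symmetric matrix Z >= G_0, the flow reads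
   Z' = F(Z) with F(Z) >= 0 quadratic in Z^-1.  The inverse is bounded and
   Lipschitz on {Z >= G_0}, which Picard iteration preserves, so the
   solution is global. *)

Require Import Defs.
From HB Require Import structures.
From mathcomp Require Import all_boot all_order all_algebra.
From mathcomp Require Import all_classical all_reals all_analysis.
From mathcomp Require Import ring lra.
Set Implicit Arguments. Unset Strict Implicit. Unset Printing Implicit Defensive.
Import Order.TTheory GRing.Theory Num.Theory.
Import numFieldNormedType.Exports.
Local Open Scope classical_set_scope.
Local Open Scope ring_scope.

(** The obstacle is the V-block [h]: it is nonincreasing along the flow, and a long-time solution
    must keep it from degenerating. On V, Ric^{1,1} has the form [h T h / 8], so passing to
    [p = h^-1] cancels both factors [h], and [p'] depends on [k^-1] alone. After that [h] enters
    only the equation of [k], linearly and as [p^-1], which makes the field a polynomial in the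
    entries of [Z^-1]. Its coefficients [1/4] and [1/8] are the Ricci coefficients [1/2] and [1/4],
    halved by the averaging over [J].

    A bounded field with one Lipschitz constant for the whole domain replaces every continuation or
    blow-up argument: Picard iteration converges on the entire half-line in an exponentially
    weighted norm. Since [Z t >= G_0] is available for [t >= 0] only, the inverse is not controlled
    at negative times, and the metric rebuilt from [Z] is differentiated at time 0 from the
    right. *)

(** * Calculus on the half-line *)

Lemma is_derive_nonneg_le (R : realType) (f df : R -> R) (a b : R) :
  (forall t : R, a <= t -> is_derive t 1 f (df t)) ->
  (forall t : R, a <= t -> 0 <= df t) -> a <= b -> f a <= f b.
Proof.
move=> fd df0 ab.
have [c|c|c] := @MVT_segment R f df a b ab.
- by rewrite in_itv/= => /andP[/ltW ac _]; exact: fd.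
- apply: derivable_within_continuous => x; rewrite in_itv/= => /andP[ax _].
  by have [] := fd x ax.
rewrite in_itv/= => /andP[ac _] e.
by rewrite -subr_ge0 e mulr_ge0 ?subr_ge0 ?df0.
Qed.

(** Both [g - f] and [g + f] are nondecreasing. This mean value inequality stands in for estimates
    of integrals throughout. *)
Lemma is_derive_norm_le (R : realType) (f df g dg : R -> R) (a b : R) :
  (forall t : R, a <= t -> is_derive t 1 f (df t)) ->
  (forall t : R, a <= t -> is_derive t 1 g (dg t)) ->
  (forall t : R, a <= t -> `|df t| <= dg t) -> a <= b ->
  `|f b - f a| <= g b - g a.
Proof.
move=> fd gd le ab.
have h1 : (g - f) a <= (g - f) b.
  apply: (@is_derive_nonneg_le _ _ (fun t => dg t - df t)) => // t at_.
    by have ? := fd _ at_; have ? := gd _ at_; exact: is_deriveB.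
  by have := le _ at_; rewrite ler_norml subr_ge0 => /andP[].
have h2 : (g + f) a <= (g + f) b.
  apply: (@is_derive_nonneg_le _ _ (fun t => dg t + df t)) => // t at_.
    by have ? := fd _ at_; have ? := gd _ at_; exact: is_deriveD.
  by have := le _ at_; rewrite ler_norml => /andP[]; lra.
move: h1 h2; rewrite !fctE ler_norml => h1 h2; apply/andP; split; lra.
Qed.

(** The integral starts at [-1] so that [0] is an interior point and the fundamental theorem gives a
    two-sided derivative there; the second term restores the value [0] at [0]. *)
Definition primitive (R : realType) (f : R -> R) (t : R) : R :=
  (\int[lebesgue_measure]_(s in `[-1, t]) f s)%R -
  (\int[lebesgue_measure]_(s in `[-1, (0:R)]) f s)%R.

Lemma primitive0 (R : realType) (f : R -> R) : primitive f 0 = 0.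
Proof. exact: subrr. Qed.

Lemma is_derive_primitive (R : realType) (f : R -> R) (t : R) :
  continuous f -> 0 <= t -> is_derive t 1 (primitive f) (f t).
Proof.
move=> cf t0.
have intf : lebesgue_measure.-integrable `[-1, t + 1] (EFin \o f).
  apply: continuous_compact_integrable; first exact: segment_compact.
  exact: continuous_subspaceT.
have [|||d e] := @continuous_FTC1_closed R f (-1) t (t + 1) _ intf.
- by rewrite ltrDl.
- lra.
- exact: cf.
set I := (fun y : R => _) in d e.
have dI : is_derive t 1 I (f t) by split; [exact: d|rewrite -derive1E; exact: e].
have dc := @is_derive_cst R R R (I 0) t 1.
have := @is_deriveB R R R I (cst (I 0)) t 1 _ _ dI dc.
by rewrite subr0.
Qed.

Lemma lipschitz_continuous (R : realType) (f : R -> R) (k : R) :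
  (forall s t : R, `|f s - f t| <= k * `|s - t|) -> continuous f.
Proof.
move=> lip t; apply/cvgrPdist_le => /= e e0.
have k0 : 0 < `|k| + 1 by rewrite ltr_pwDr.
near=> s; apply: (le_trans (lip _ _)).
apply: (@le_trans _ _ ((`|k| + 1) * `|t - s|)).
  by rewrite ler_wpM2r// (le_trans (ler_norm k))// lerDl.
rewrite -ler_pdivlMl//; near: s; apply: cvgr_dist_le.
  exact: cvg_id.
by rewrite mulr_gt0// invr_gt0.
Unshelve. all: by end_near. Qed.

Lemma cvg_div_pow2 (R : realType) (c : R) :
  (fun k => c / 2 ^+ k) @ \oo --> (0 : R).
Proof.
have -> : (fun k => c / 2 ^+ k) = fun k => c * (1 / 2) ^+ k.
  by apply/funext => k; rewrite expr_div_n expr1n mul1r.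
rewrite -[X in _ --> X](mulr0 c).
apply: cvgM; first exact: cvg_cst.
apply: cvg_expr; rewrite ger0_norm; lra.
Qed.

Lemma le_div_pow2_le0 (R : realType) (a c : R) :
  (forall k, a <= c / 2 ^+ k) -> a <= 0.
Proof.
move=> le; rewrite -(cvg_lim _ (cvg_div_pow2 c))//.
by apply: limr_ge; [apply: cvgP (cvg_div_pow2 c)|apply: nearW].
Qed.

Lemma is_derive_expR_scale (R : realType) (a b t : R) :
  is_derive t 1 (fun s : R => a * expR (b * s)) (a * (b * expR (b * t))).
Proof.
have d1 : is_derive t 1 (fun s : R => b * s) b.
  by have := @is_deriveZ _ _ _ id b t 1 1 _; rewrite [b *: 1]mulr1; apply.
have d2 := @is_derive1_comp _ expR (fun s : R => b * s) t _ _
  (is_derive_expR (b * t)) d1.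
by have := @is_deriveZ _ _ _ _ a t 1 _ d2; rewrite [expR _ * b]mulrC.
Qed.

(* Evaluating [u] at [`|s|] makes the integrand continuous on the whole line,
   so the derivatives below are two-sided even at [0]. *)
Definition picard_step (R : realType) (m n : nat)
    (F : 'M[R]_(m, n) -> 'M[R]_(m, n)) (x0 : 'M[R]_(m, n))
    (u : R -> 'M[R]_(m, n)) (t : R) : 'M[R]_(m, n) :=
  \matrix_(i, j) (x0 i j + primitive (fun s : R => F (u `|s|) i j) t).

(** The bound [M] on the speed makes the integrand of the next Picard step continuous. *)
Definition lip_curve (R : realType) (m n : nat) (K : 'M[R]_(m, n) -> Prop)
    (M : R) (u : R -> 'M[R]_(m, n)) : Prop :=
  (forall t : R, 0 <= t -> K (u t)) /\
  (forall s t : R, 0 <= s -> 0 <= t -> forall i j,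
     `|u s i j - u t i j| <= M * `|s - t|).

(** * Global Picard iteration on a closed invariant set *)

Section Picard.
Context (R : realType) (m n : nat) (K : 'M[R]_(m, n) -> Prop).
Context (F : 'M[R]_(m, n) -> 'M[R]_(m, n)) (x0 : 'M[R]_(m, n)) (L M : R).
Hypothesis L_gt0 : 0 < L.
Hypothesis M_ge0 : 0 <= M.
Hypothesis K_x0 : K x0.
Hypothesis K_closed : forall (u : nat -> 'M[R]_(m, n)) (A : 'M[R]_(m, n)),
  (forall k, K (u k)) ->
  (forall i j, (fun k => u k i j) @ \oo --> A i j) -> K A.
Hypothesis F_bounded : forall A i j, K A -> `|F A i j| <= M.
Hypothesis F_lipschitz : forall A B (e : R), K A -> K B ->
  (forall i j, `|A i j - B i j| <= e) ->
  forall i j, `|F A i j - F B i j| <= L * e.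
(** Two curves occur because each iterate [y] is driven by the field along the previous iterate [z],
    not along itself. *)
Hypothesis K_invariant : forall y z : R -> 'M[R]_(m, n),
  (forall t : R, 0 <= t -> K (z t)) -> y 0 = x0 ->
  (forall t : R, 0 <= t -> forall i j,
     is_derive t 1 (fun s : R => y s i j) (F (z t) i j)) ->
  forall t : R, 0 <= t -> K (y t).

Local Notation step := (picard_step F x0).
Local Notation lipc := (lip_curve K M).

Lemma picard_step0 u : step u 0 = x0.
Proof. by apply/matrixP => i j; rewrite mxE primitive0 addr0. Qed.

Lemma is_derive_picard_step u (t : R) i j : lipc u -> 0 <= t ->
  is_derive t 1 (fun s : R => step u s i j) (F (u t) i j).
Proof.
move=> [Ku lipu] t0.
have cf : continuous (fun s : R => F (u `|s|) i j).
  apply: (@lipschitz_continuous _ _ (L * M)) => s r.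
  rewrite -mulrA; apply: F_lipschitz; [exact: Ku|exact: Ku|] => i' j'.
  apply: (le_trans (lipu _ _ _ _ _ _)) => //.
  by rewrite ler_wpM2l// ler_dist_dist.
have := is_derive_primitive cf t0.
rewrite (ger0_norm t0) => d.
have -> : (fun s : R => step u s i j) =
    cst (x0 i j) + primitive (fun s : R => F (u `|s|) i j).
  by apply/funext => s; rewrite mxE fctE.
by rewrite -[F _ _ _]add0r; exact: is_deriveD.
Qed.

Lemma lip_curve_picard_step u : lipc u -> lipc (step u).
Proof.
move=> lu; split.
  apply: (K_invariant (z := u)); first exact: lu.1.
    exact: picard_step0.
  by move=> t t0 i j; exact: is_derive_picard_step.
move=> s t s0 t0 i j.
wlog st : s t s0 t0 / t <= s.
  move=> H; have [ts|/ltW st] := leP t s; first exact: H.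
  by rewrite distrC (distrC s); exact: H.
rewrite (ger0_norm (_ : 0 <= s - t)) ?subr_ge0// mulrBr.
apply: (@is_derive_norm_le _ (fun s : R => step u s i j)
  (fun r => F (u r) i j) (fun r => M * r) (fun=> M)) => // r tr.
- by apply: is_derive_picard_step => //; exact: le_trans tr.
- have := @is_deriveZ _ _ _ id M r 1 1 _.
  by rewrite [M *: 1]mulr1; apply.
- by apply/F_bounded/lu.1; exact: le_trans tr.
Qed.

(* Picard iteration contracts by 1/2 in the norm weighted by [exp (- 2 L t)]. *)
Lemma picard_step_contract u v b : lipc u -> lipc v ->
  (forall t : R, 0 <= t -> forall i j,
     `|u t i j - v t i j| <= b * expR (2 * L * t)) ->
  forall t : R, 0 <= t -> forall i j,
     `|step u t i j - step v t i j| <= b / 2 * expR (2 * L * t).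
Proof.
move=> lu lv uv t t0 i j.
have [I | nI] := pselect (0 <= b); last first.
  have := uv 0 (lexx 0) i j; rewrite mulr0 expR0 mulr1 => h.
  by have := le_trans (normr_ge0 _) h.
have D (r : R) : 0 <= r -> is_derive r 1
    ((fun s : R => step u s i j) - (fun s : R => step v s i j))
    (F (u r) i j - F (v r) i j).
  move=> r0; apply: is_deriveB; exact: is_derive_picard_step.
have := @is_derive_norm_le _ _ _ (fun s : R => b / 2 * expR (2 * L * s))
  _ 0 t D (fun r _ => is_derive_expR_scale _ _ _) _ t0.
rewrite !fctE !picard_step0 subrr subr0 mulr0 expR0 mulr1 => H.
have {}H := H _; apply: (le_trans (H _)); last by lra.
move=> r r0; apply: (le_trans (F_lipschitz (lu.1 _ r0) (lv.1 _ r0) (uv _ r0) i j)).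
by rewrite le_eqVlt; apply/orP; left; apply/eqP; field.
Qed.

Lemma lip_curve_cst : lipc (cst x0).
Proof.
split=> // s t _ _ i j; rewrite subrr normr0.
by rewrite mulr_ge0.
Qed.

Let u k := iter k (fun v => step v) (cst x0).

Let lip_u k : lipc (u k).
Proof. by elim: k => [|k IH]; [exact: lip_curve_cst|exact: lip_curve_picard_step]. Qed.

(** Chosen so that [C * expR (2 * L * t)] has derivative [M * expR (2 * L * t) >= M] for [t >= 0],
    and thus bounds the first increment. *)
Let C := M / (2 * L).

Let dist_u k (t : R) i j : 0 <= t ->
  `|u k.+1 t i j - u k t i j| <= C / 2 ^+ k * expR (2 * L * t).
Proof.
move=> t0; elim: k t t0 i j => [|k IH] t t0 i j.
  have := @is_derive_norm_le _ _ _ (fun s : R => C * expR (2 * L * s))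
    _ 0 t (fun r r0 => is_derive_picard_step i j lip_curve_cst r0)
    (fun r _ => is_derive_expR_scale _ _ _) _ t0.
  rewrite picard_step0 mulr0 expR0 mulr1 expr0 divr1 => H.
  apply: (le_trans (H _)) => [r r0|].
    apply: (le_trans (F_bounded _ _ K_x0)).
    have -> : C * (2 * L * expR (2 * L * r)) = M * expR (2 * L * r).
      by rewrite /C; field; rewrite lt0r_neq0.
    by rewrite ler_peMr// -expR0 ler_expR !mulr_ge0// ltW.
  by rewrite lerBlDr lerDl divr_ge0// mulr_ge0// ltW.
rewrite exprSr invfM mulrA.
apply: (@picard_step_contract (u k.+1) (u k) (C / 2 ^+ k)) => //.
Qed.

Let E t := expR (2 * L * t).

(** The increments are at most [b k / 2] and [b] halves at each step, so [u k - b k] is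
    nondecreasing and [u k + b k] nonincreasing. Their common limit lies between them, which gives
    existence and rate together; [2 * C] sums the geometric tail. *)
Lemma picard_limit (t : R) : 0 <= t -> forall i j, exists l : R,
  (fun k => u k t i j) @ \oo --> l /\
  forall k, `|l - u k t i j| <= 2 * C / 2 ^+ k * E t.
Proof.
move=> t0 i j.
pose b k : R := 2 * C / 2 ^+ k * E t.
have bS k : b k.+1 = b k / 2.
  by rewrite /b exprS; field; rewrite expf_neq0// pnatr_eq0.
have b0 k : 0 <= b k.
  rewrite mulr_ge0 ?expR_ge0// divr_ge0 ?exprn_ge0// mulr_ge0//.
  by rewrite divr_ge0// mulr_ge0// ltW.
have du k : `|u k.+1 t i j - u k t i j| <= b k / 2.
  apply: le_trans (dist_u k i j t0) _; rewrite /b le_eqVlt; apply/orP; left.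
  by apply/eqP; rewrite /E; field; rewrite expf_neq0// pnatr_eq0.
have nd : nondecreasing_seq (fun k => u k t i j - b k).
  apply/nondecreasing_seqP => k; rewrite bS.
  by have := du k; rewrite ler_norml => /andP[]; lra.
have ni : nonincreasing_seq (fun k => u k t i j + b k).
  apply/nonincreasing_seqP => k; rewrite bS.
  by have := du k; rewrite ler_norml => /andP[]; lra.
have cb : b @ \oo --> 0.
  have -> : b = fun k => 2 * C * E t / 2 ^+ k.
    by apply/funext => k; rewrite /b mulrAC.
  exact: cvg_div_pow2.
have c1 : cvgn (fun k => u k t i j - b k).
  apply: nondecreasing_is_cvgn nd _; exists (u 0%N t i j + b 0%N) => _ [k _ <-].
  have := ni 0%N k (leq0n k); have := b0 k; lra.
have c1' : (fun k => u k t i j) @ \oo --> limn (fun k => u k t i j - b k).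
  rewrite -[X in _ --> X]addr0.
  have -> : (fun k => u k t i j) = (fun k => u k t i j - b k) \+ b.
    by apply/funext => k /=; rewrite subrK.
  exact: cvgD.
exists (limn (fun k => u k t i j - b k)); split=> // k.
have h1 := nondecreasing_cvgn_le nd c1 k.
have c2 : (fun k => u k t i j + b k) @ \oo --> limn (fun k => u k t i j - b k).
  by rewrite -[X in _ --> X]addr0; apply: cvgD.
have h2 := nonincreasing_cvgn_ge ni (cvgP _ c2) k.
rewrite (cvg_lim _ c2) // in h2.
rewrite ler_norml -/(b k); apply/andP; split; lra.
Qed.

Theorem picard_global : exists x : R -> 'M[R]_(m, n), x 0 = x0 /\
  forall t : R, 0 <= t -> K (x t) /\
    forall i j, is_derive t 1 (fun s : R => x s i j) (F (x t) i j).
Proof.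
pose x (t : R) : 'M[R]_(m, n) :=
  \matrix_(i, j) limn (fun k => u k t i j).
have cx (t : R) i j : 0 <= t -> (fun k => u k t i j) @ \oo --> x t i j.
  by move=> t0; have [l [cl _]] := picard_limit t0 i j; rewrite mxE (cvg_lim _ cl).
have dx (t : R) k i j : 0 <= t -> `|x t i j - u k t i j| <= 2 * C / 2 ^+ k * E t.
  by move=> t0; have [l [cl]] := picard_limit t0 i j; rewrite mxE (cvg_lim _ cl).
have lx : lipc x.
  split=> [t t0|s t s0 t0 i j].
    apply: (@K_closed (fun k => u k t)) => [k|i j]; last exact: cx.
    exact: (lip_u k).1.
  apply: (@closed_cvg _ _ _ eventually_filter
     (fun k => `|u k s i j - u k t i j|) (fun r => r <= M * `|s - t|)).
  - exact: closed_le.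
  - by apply: nearW => k; apply: (lip_u k).2.
  - by apply: cvg_norm; apply: cvgB; exact: cx.
have yx (t : R) : 0 <= t -> step x t = x t.
  move=> t0; apply/matrixP => i j.
  have d k : `|step x t i j - u k.+1 t i j| <= 2 * C / 2 ^+ k / 2 * E t.
    by apply: (@picard_step_contract x (u k)) => // s s0 i' j'; exact: dx.
  apply/eqP; rewrite -subr_eq0 -normr_le0.
  apply: (@le_div_pow2_le0 _ _ (2 * C * E t)) => k.
  have h1 := d k; have h2 := dx t k.+1 i j t0.
  rewrite -(subrK (u k.+1 t i j) (step x t i j)) -addrA.
  apply: (le_trans (ler_normD _ _)).
  rewrite (distrC _ (x t i j)); apply: (le_trans (lerD h1 h2)).
  rewrite le_eqVlt exprS; apply/orP; left; apply/eqP; field.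
  by rewrite expf_neq0// pnatr_eq0.
(* [x] and [step x] agree for nonnegative times only; [step x] is the witness because it is
   differentiable from both sides at [0]. *)
exists (step x); split; first exact: picard_step0.
move=> t t0; split; first by rewrite yx//; exact: lx.1.
by move=> i j; rewrite yx//; exact: is_derive_picard_step.
Qed.
End Picard.

(** * Bilinear forms and Gram matrices *)

Section InnerProduct.
Context (R : realType) (m : nat).
Implicit Types (A B G H : 'M[R]_m) (x y : 'rV[R]_m).

Lemma ip_sum A x y : ip A x y = \sum_i \sum_j x 0 i * A i j * y 0 j.
Proof.
rewrite /ip mxE exchange_big; apply: eq_bigr => j _.
by rewrite !mxE big_distrl.
Qed.

Lemma ip_evec A i j : ip A (evec R i) (evec R j) = A i j.
Proof. by rewrite /ip /evec -rowE trmx_delta -colE !mxE. Qed.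

Lemma ipD A B x y : ip (A + B) x y = ip A x y + ip B x y.
Proof. by rewrite /ip mulmxDr mulmxDl mxE. Qed.

Lemma ipN A x y : ip (- A) x y = - ip A x y.
Proof. by rewrite /ip mulmxN mulNmx mxE. Qed.

Lemma ipB A B x y : ip (A - B) x y = ip A x y - ip B x y.
Proof. by rewrite ipD ipN. Qed.

Lemma ipZ a A x y : ip (a *: A) x y = a * ip A x y.
Proof. by rewrite /ip -scalemxAr -scalemxAl mxE. Qed.

Lemma ip_congr B A x y : ip (B *m A *m B^T) x y = ip A (x *m B) (y *m B).
Proof. by rewrite /ip trmx_mul !mulmxA. Qed.

Lemma ip_tr A x y : ip A^T x y = ip A y x.
Proof.
by rewrite /ip -[in RHS](trmxK (y *m A *m x^T)) [RHS]mxE !trmx_mul trmxK mulmxA.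
Qed.

Lemma ipDl A x y z : ip A (x + y) z = ip A x z + ip A y z.
Proof. by rewrite /ip !mulmxDl mxE. Qed.

Lemma ipDr A x y z : ip A z (x + y) = ip A z x + ip A z y.
Proof. by rewrite -!(ip_tr A) ipDl. Qed.

Lemma ipZl A a x y : ip A (a *: x) y = a * ip A x y.
Proof. by rewrite /ip -!scalemxAl mxE. Qed.

Lemma ipZr A a x y : ip A x (a *: y) = a * ip A x y.
Proof. by rewrite -!(ip_tr A) ipZl. Qed.

Lemma ipNl A x y : ip A (- x) y = - ip A x y.
Proof. by rewrite -scaleN1r ipZl mulN1r. Qed.

Lemma ip_ext A B : (forall x y, ip A x y = ip B x y) -> A = B.
Proof. by move=> e; apply/matrixP => i j; rewrite -!ip_evec. Qed.

Lemma trmx_scalar (M : 'M[R]_1) : M^T = M.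
Proof. by apply/matrixP => i j; rewrite mxE !ord1. Qed.

Definition comb (X : 'I_m -> 'M[R]_m) x : 'M[R]_m := \sum_k x 0 k *: X k.

(** With [G] a metric and [H] its inverse, the family [adk] below yields [sum_i g([y,e_i],[z,e_i])]
    over an orthonormal basis. The family [coadk], with the inverse metric in both places, yields
    the other sum of the Ricci formula with its indices raised. *)
Definition gram (X : 'I_m -> 'M[R]_m) G H : 'M[R]_m :=
  \matrix_(k, l) \tr (X k *m G *m (X l)^T *m H).

Lemma comb_evec X k : comb X (evec R k) = X k.
Proof.
rewrite /comb (bigD1 k)//= big1 => [|l lk].
  by rewrite addr0 mxE !eqxx scale1r.
by rewrite mxE (negPf lk) andbF scale0r.
Qed.

Lemma ip_gram X G H x y :
  ip (gram X G H) x y = \tr (comb X x *m G *m (comb X y)^T *m H).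
Proof.
rewrite ip_sum /comb !mulmx_suml raddf_sum /=; apply: eq_bigr => k _.
rewrite raddf_sum /= mulmx_sumr mulmx_suml raddf_sum /=.
apply: eq_bigr => l _; rewrite mxE linearZ /= -!scalemxAl -!scalemxAr.
by rewrite -!scalemxAl !mxtraceZ; ring.
Qed.

Lemma tr_gram X G H : G^T = G -> H^T = H -> (gram X G H)^T = gram X G H.
Proof.
move=> GT HT; apply/matrixP => k l; rewrite !mxE -mxtrace_tr !trmx_mul trmxK.
by rewrite GT HT -mxtrace_mulC !mulmxA.
Qed.

Lemma comb_eq0_gram D X G H :
  (forall x, comb X (x *m D) = 0) -> D *m gram X G H = 0.
Proof.
move=> D0; apply: ip_ext => x y; rewrite [RHS]/ip mulmx0 mul0mx mxE.
have -> : ip (D *m gram X G H) x y = ip (gram X G H) (x *m D) y.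
  by rewrite /ip !mulmxA.
by rewrite ip_gram D0 !mul0mx mxtrace0.
Qed.

(** By cyclicity of the trace, [G] matters only on the images of the [X k] and [H] only modulo their
    kernels. This allows a metric to be replaced by a simpler form agreeing with it there. *)
Lemma eq_gram X G H G' H' :
  (forall k l, X k *m G *m (X l)^T = X k *m G' *m (X l)^T) ->
  (forall k l, (X l)^T *m H *m X k = (X l)^T *m H' *m X k) ->
  gram X G H = gram X G' H'.
Proof.
move=> eG eH; apply/matrixP => k l; rewrite !mxE eG.
have cyc (K M N : 'M[R]_m) : \tr (K *m M *m N *m H) = \tr (N *m H *m K *m M) :> R.
  by rewrite -mulmxA mxtrace_mulC !mulmxA.
have cyc' (K M N : 'M[R]_m) : \tr (K *m M *m N *m H') = \tr (N *m H' *m K *m M) :> R.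
  by rewrite -mulmxA mxtrace_mulC !mulmxA.
by rewrite cyc cyc' eH.
Qed.
End InnerProduct.

(** * Ricci tensor of a 2-step nilpotent Lie algebra *)

(** In a full-rank factorization [A = U V], the relation [U V U V = 0] can be cancelled on both
    sides to [V U = 0], and [U V] and [V U] have the same trace. *)
Lemma mxtrace_sqr0 (F : fieldType) (m : nat) (A : 'M[F]_m) :
  A *m A = 0 -> \tr A = 0.
Proof.
have := mulmx_base A; have := row_base_free A; have := col_base_full A.
move: (col_base A) (row_base A) => U V /row_fullP[C CU] /row_freeP[B VB] <-.
rewrite mxtrace_mulC => UV0.
suff -> : V *m U = 0 by rewrite mxtrace0.
have : C *m (U *m V *m (U *m V)) *m B = 0 by rewrite UV0 mulmx0 mul0mx.
by rewrite !mulmxA CU mul1mx -!mulmxA VB mulmx1.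
Qed.

Section Bracket.
Context (R : realType) (m : nat) (c : 'I_m -> 'I_m -> 'rV[R]_m).
Implicit Types (A B G H : 'M[R]_m) (x y z : 'rV[R]_m).

(** Row [i] is [[e_i, e_k]], so [comb adk y] acts on the right as [x -> [x, y]]. Its companion
    [coadk k] is the [k]-th coordinate of the bracket, as a bilinear form. *)
Definition adk (k : 'I_m) : 'M[R]_m := \matrix_i c i k.
Definition coadk (k : 'I_m) : 'M[R]_m := \matrix_(i, j) c i j 0 k.

Lemma br_comb x y : br c x y = x *m comb adk y.
Proof.
rewrite /br exchange_big /comb mulmx_sumr; apply: eq_bigr => j _.
rewrite -scalemxAr mulmx_sum_row scaler_sumr; apply: eq_bigr => i _.
by rewrite rowK scalerA mulrC.
Qed.

Lemma br_evec i j : br c (evec R i) (evec R j) = c i j.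
Proof. by rewrite br_comb comb_evec -rowE rowK. Qed.

Lemma comb_coadk_entry (xi : 'rV[R]_m) i j :
  comb coadk xi i j = (c i j *m xi^T) 0 0.
Proof.
rewrite /comb summxE mxE; apply: eq_bigr => k _.
by rewrite !mxE mulrC.
Qed.

Lemma ip_coadk xi x y : ip (comb coadk xi) x y = (br c x y *m xi^T) 0 0.
Proof.
rewrite ip_sum /br mulmx_suml summxE; apply: eq_bigr => i _.
rewrite mulmx_suml summxE; apply: eq_bigr => j _.
by rewrite comb_coadk_entry -scalemxAl [RHS]mxE mulrAC.
Qed.

Hypothesis anti : forall x y, br c x y = - br c y x.

Lemma tr_coadk xi : (comb coadk xi)^T = - comb coadk xi.
Proof.
apply: ip_ext => x y; rewrite ip_tr ipN !ip_coadk anti mulNmx.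
by rewrite mxE.
Qed.

Hypothesis nil : forall x y z, br c (br c x y) z = 0.

Lemma comb_adk_mul0 x y : comb adk x *m comb adk y = 0.
Proof.
by apply/row_matrixP => i; rewrite row0 rowE mulmxA -!br_comb nil.
Qed.

Context (G : 'M[R]_m).
Hypothesis G_sym : G^T = G.
Hypothesis G_unit : G \in unitmx.
Local Notation H := (invmx G).

Definition nabla x : 'M[R]_m :=
  2^-1 *: ((G *m (comb adk x)^T - comb adk x *m G - comb coadk (x *m G)) *m H).

Lemma levi_civitaE x y : levi_civita c G x y = y *m nabla x.
Proof.
rewrite /levi_civita /nabla -scalemxAr mulmxA scalemxAl; congr (_ *m _).
apply/rowP => k; rewrite [LHS]mxE [RHS]mxE /koszul !mulmxBr.
have sub (u v : 'rV[R]_m) : (u - v) 0 k = u 0 k - v 0 k by rewrite !mxE.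
have e1 : ip G (br c x y) (evec R k) = - (y *m (comb adk x *m G)) 0 k.
  rewrite anti ipNl /ip br_comb /evec trmx_delta -colE mxE.
  by rewrite mulmxA.
have e2 : ip G (br c y (evec R k)) x = (y *m comb coadk (x *m G)) 0 k.
  have <- : ip (comb coadk (x *m G)) y (evec R k) = (y *m comb coadk (x *m G)) 0 k.
    by rewrite /ip /evec trmx_delta -colE mxE.
  by rewrite ip_coadk /ip trmx_mul G_sym mulmxA.
have e3 : ip G (br c (evec R k) x) y = (y *m (G *m (comb adk x)^T)) 0 k.
  rewrite -ip_tr G_sym /ip br_comb trmx_mul /evec trmx_delta !mulmxA -colE.
  by rewrite mxE.
by rewrite e1 e2 e3 !sub; field.
Qed.

Lemma levi_civita_torsion x y :
  levi_civita c G x y = levi_civita c G y x + br c x y.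
Proof.
rewrite /levi_civita -[br c x y in RHS](mulmxK G_unit) -mulmxDl; congr (_ *m _).
apply/rowP => k; rewrite !mxE.
have -> : \sum_j br c x y 0 j * G j k = ip G (br c x y) (evec R k).
  by rewrite /ip /evec trmx_delta -colE !mxE.
rewrite /koszul (anti y x) (anti x (evec R k)) (anti (evec R k) y) !ipNl.
by field.
Qed.

Lemma mxtrace_row A : \tr A = \sum_i (evec R i *m A) 0 i.
Proof. by apply: eq_bigr => i _; rewrite -rowE mxE. Qed.

(** The two terms in [comb adk x] have the trace of a square-zero matrix, and the third pairs a skew
    matrix with the symmetric [H]. *)
Lemma mxtrace_nabla x : \tr (nabla x) = 0.
Proof.
have HT : H^T = H by rewrite trmx_inv G_sym.
have A0 := mxtrace_sqr0 (comb_adk_mul0 x x).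
rewrite /nabla mxtraceZ !mulmxBl !raddfB /= mulmxK// A0.
rewrite mxtrace_mulC mulmxA mulVmx// mul1mx mxtrace_tr A0.
suff -> : \tr (comb coadk (x *m G) *m H) = 0 by rewrite !subr0 mulr0.
have : \tr (comb coadk (x *m G) *m H) = - \tr (comb coadk (x *m G) *m H).
  rewrite -{1}mxtrace_tr trmx_mul HT tr_coadk mulmxN raddfN /=.
  by rewrite mxtrace_mulC.
by lra.
Qed.

(** Vanishing torsion moves the traced variable to the last slot in each term of the curvature. The
    first term then has trace zero, and in the last one [[[x,y],z]] vanishes. *)
Lemma ricci_trace y z : ricci c G y z =
  - \tr (nabla z *m nabla y) - \tr (comb adk z *m nabla y)
  - \tr (comb adk y *m nabla z).
Proof.
rewrite /ricci /curvature.
transitivity (\sum_i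
    ((levi_civita c G (evec R i) (levi_civita c G y z)) 0 i
     - (levi_civita c G y (levi_civita c G (evec R i) z)) 0 i
     - (levi_civita c G (br c (evec R i) y) z) 0 i)).
  by apply: eq_bigr => i _; rewrite !mxE.
rewrite !sumrB.
have -> : \sum_i (levi_civita c G (evec R i) (levi_civita c G y z)) 0 i = 0.
  set w := levi_civita c G y z.
  transitivity (\tr (nabla w + comb adk w)).
    rewrite mxtrace_row; apply: eq_bigr => i _.
    by rewrite levi_civita_torsion levi_civitaE br_comb mulmxDr.
  by rewrite raddfD /= mxtrace_nabla mxtrace_sqr0 ?addr0// comb_adk_mul0.
have -> : \sum_i (levi_civita c G y (levi_civita c G (evec R i) z)) 0 i
    = \tr (nabla z *m nabla y) + \tr (comb adk z *m nabla y).
  rewrite -raddfD /= -mulmxDl mxtrace_row; apply: eq_bigr => i _.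
  by rewrite levi_civitaE levi_civita_torsion levi_civitaE br_comb -mulmxDr mulmxA.
have -> : \sum_i (levi_civita c G (br c (evec R i) y) z) 0 i
    = \tr (comb adk y *m nabla z).
  rewrite mxtrace_row; apply: eq_bigr => i _.
  by rewrite levi_civita_torsion nil addr0 levi_civitaE br_comb mulmxA.
by rewrite sub0r opprD.
Qed.

Lemma ricci_gram y z : ricci c G y z =
  ip (G *m gram coadk H H *m G) y z / 4 - ip (gram adk G H) y z / 2.
Proof.
have HT : H^T = H by rewrite trmx_inv G_sym.
have -> : ip (G *m gram coadk H H *m G) y z = ip (gram coadk H H) (y *m G) (z *m G).
  by rewrite -ip_congr G_sym.
rewrite !ip_gram tr_coadk ricci_trace /nabla.
set A := comb adk y; set a := comb adk z.
set B := comb coadk (y *m G); set b := comb coadk (z *m G).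
have BT : B^T = - B by exact: tr_coadk.
have bT : b^T = - b by exact: tr_coadk.
have aA0 : a *m A = 0 by exact: comb_adk_mul0.
have Aa0 : A *m a = 0 by exact: comb_adk_mul0.
have GH : G *m H = 1%:M by exact: mulmxV.
have HG : H *m G = 1%:M by exact: mulVmx.
rewrite -!scalemxAl -!scalemxAr !mxtraceZ.
rewrite !(mulmxBl, mulmxBr) ?(raddfB (@mxtrace R m)) /=.
rewrite !mulmxA.
have trT (M N : 'M[R]_m) : M^T = N -> \tr M = \tr N.
  by move=> <-; rewrite mxtrace_tr.
(* Transposition and cyclicity reduce every trace to [\tr (A *m G *m a^T *m H)],
   [\tr (b *m H *m B *m H)] or one of the mixed [\tr (a *m B *m H)], [\tr (A *m b *m H)]. The mixed
   ones cancel in the total. *)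
have s1 : \tr (a *m G *m A^T *m H) = \tr (A *m G *m a^T *m H).
  rewrite (trT _ (H *m (A *m G *m a^T))); first by rewrite mxtrace_mulC.
  by rewrite !trmx_mul HT G_sym trmxK !mulmxA.
have t1 : \tr (G *m a^T *m H *m G *m A^T *m H) = 0.
  rewrite (trT _ (H *m (A *m a *m G))); last first.
    by rewrite !trmx_mul HT G_sym !trmxK -!mulmxA (mulmxA G H) GH mul1mx.
  by rewrite Aa0 mul0mx mulmx0 mxtrace0.
have t2 : \tr (G *m a^T *m H *m A *m G *m H) = \tr (A *m G *m a^T *m H).
  by rewrite -(mulmxA _ G H) GH mulmx1 -mulmxA mxtrace_mulC -!mulmxA mxtrace_mulC
    -!mulmxA mxtrace_mulC !mulmxA.
have t3 : \tr (G *m a^T *m H *m B *m H) = - \tr (a *m B *m H).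
  rewrite (trT _ (- (H *m (B *m H *m a *m G)))).
    rewrite raddfN /= mxtrace_mulC -!mulmxA GH mulmx1 mulmxA mxtrace_mulC.
    by rewrite mulmxA.
  by rewrite !trmx_mul HT G_sym trmxK BT mulNmx mulmxN !mulmxA.
have t4 : \tr (a *m G *m H *m G *m A^T *m H) = \tr (A *m G *m a^T *m H).
  by rewrite -(mulmxA a G H) GH mulmx1 s1.
have t5 : \tr (a *m G *m H *m A *m G *m H) = 0.
  by rewrite -(mulmxA a G H) GH mulmx1 aA0 !mul0mx mxtrace0.
have t6 : \tr (a *m G *m H *m B *m H) = \tr (a *m B *m H).
  by rewrite -(mulmxA a G H) GH mulmx1.
have t7 : \tr (b *m H *m G *m A^T *m H) = - \tr (A *m b *m H).
  rewrite -(mulmxA b H G) HG mulmx1 (trT _ (- (H *m (A *m b)))).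
    by rewrite raddfN /= mxtrace_mulC.
  by rewrite !trmx_mul HT trmxK bT !mulmxN !mulmxA.
have t8 : \tr (b *m H *m A *m G *m H) = \tr (A *m b *m H).
  by rewrite -(mulmxA _ G H) GH mulmx1 mxtrace_mulC mulmxA.
have t9 : \tr (B *m H *m - b *m H) = - \tr (b *m H *m B *m H).
  by rewrite mulmxN mulNmx raddfN /= -(mulmxA _ b H) mxtrace_mulC mulmxA.
have t10 : \tr (a *m A *m G *m H) = 0 by rewrite aA0 !mul0mx mxtrace0.
have t11 : \tr (A *m a *m G *m H) = 0 by rewrite Aa0 !mul0mx mxtrace0.
rewrite t1 t2 t3 t4 t5 t6 t7 t8 t9 t10 t11 s1.
by field.
Qed.
End Bracket.

(** * Positive semidefinite matrices and bounds on the inverse *)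

Section Psd.
Context (R : realType) (m : nat).
Implicit Types (A B G H M Z : 'M[R]_m) (x y : 'rV[R]_m).

Definition psd A := A^T = A /\ forall x, 0 <= ip A x x.

Lemma psd_metric G : is_metric G -> psd G.
Proof.
move=> [GT Gp]; split=> // x; have [->|/Gp/ltW//] := eqVneq x 0.
by rewrite /ip !mul0mx mxE.
Qed.

Lemma psdD A B : psd A -> psd B -> psd (A + B).
Proof.
move=> [AT Ap] [BT Bp]; split; first by rewrite linearD /= AT BT.
by move=> x; rewrite ipD addr_ge0.
Qed.

Lemma psdZ a A : 0 <= a -> psd A -> psd (a *: A).
Proof.
move=> a0 [AT Ap]; split; first by rewrite linearZ /= AT.
by move=> x; rewrite ipZ mulr_ge0.
Qed.

Lemma psd_congr B A : psd A -> psd (B *m A *m B^T).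
Proof.
move=> [AT Ap]; split; first by rewrite !trmx_mul trmxK AT mulmxA.
by move=> x; rewrite ip_congr.
Qed.

Lemma psd_ip_sym A x y : psd A -> ip A x y = ip A y x.
Proof. by move=> [AT _]; rewrite -{1}AT ip_tr. Qed.

Lemma psd_add A x y a : psd A ->
  0 <= ip A x x + 2 * a * ip A x y + a ^+ 2 * ip A y y.
Proof.
move=> pA; have := pA.2 (x + a *: y).
rewrite ipDl !ipDr !ipZl !ipZr (psd_ip_sym y x pA) => h.
apply: le_trans h _; rewrite le_eqVlt; apply/orP; left; apply/eqP; ring.
Qed.

Lemma psd_diag0 A k j : psd A -> A k k = 0 -> A k j = 0.
Proof.
move=> pA A0; apply/eqP; apply: contraT => nz.
(* With this [a], the form takes the value [-1] at [e_j + a e_k]. *)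
pose a := - (A j j + 1) / (2 * A k j).
have := psd_add (evec R j) (evec R k) a pA.
rewrite (psd_ip_sym _ _ pA) !ip_evec A0 mulr0 addr0.
have -> : 2 * a * A k j = - (A j j + 1) by rewrite /a; field.
lra.
Qed.

Lemma mxtrace_outer (v : 'rV[R]_m) H : \tr (v^T *m v *m H) = ip H v v.
Proof. by rewrite -mulmxA mxtrace_mulC /mxtrace big_ord1. Qed.

(* Symmetric Gaussian elimination, one index at a time, peels positive
   multiples of the rank one matrices [v^T *m v] off [A]. *)
Lemma psd_mxtrace_ge0 A H : psd A -> psd H -> 0 <= \tr (A *m H).
Proof.
move=> pA pH.
suff Hn n B : psd B -> (forall i j : 'I_m, (n <= i)%N -> B i j = 0) ->
    0 <= \tr (B *m H).
  by apply: (Hn m) => // i j; rewrite leqNgt ltn_ord.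
elim: n B => [|n IH] B pB B0.
  have -> : B = 0 by apply/matrixP => i j; rewrite B0 ?mxE.
  by rewrite mul0mx mxtrace0.
have [nm|mn] := ltnP n m; last first.
  by apply: IH => // i j ni; have := ltn_ord i; rewrite ltnNge (leq_trans mn).
pose k := Ordinal nm.
have B0k j : B k k = 0 -> B k j = 0 by exact: psd_diag0.
have [z|nz] := eqVneq (B k k) 0.
  apply: IH => // i j; rewrite leq_eqVlt => /orP[/eqP e|]; last exact: B0.
  have -> : i = k by exact: val_inj.
  exact: B0k.
have pos : 0 < B k k.
  by rewrite lt_neqAle eq_sym nz /= -(ip_evec B) pB.2.
pose v := row k B.
have vE x : (x *m v^T) 0 0 = ip B x (evec R k).
  rewrite /ip /v -[in RHS]pB.1 -mulmxA; congr ((_ *m _) 0 0).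
  by rewrite /evec -trmx_mul -rowE.
pose C := B - (B k k)^-1 *: (v^T *m v).
have CE i j : C i j = B i j - (B k k)^-1 * (B k i * B k j).
  by rewrite !mxE big_ord1 !mxE.
have BT i j : B i j = B j i by rewrite -{1}pB.1 mxE.
have -> : B = C + (B k k)^-1 *: (v^T *m v) by rewrite subrK.
rewrite mulmxDl raddfD /= -scalemxAl mxtraceZ mxtrace_outer.
rewrite addr_ge0//; last by rewrite mulr_ge0 ?pH.2// invr_ge0 ltW.
apply: IH => [|i j].
  split; first by apply/matrixP => i j; rewrite mxE !CE BT [X in _ * X]mulrC.
  move=> x.
  have -> : ip C x x = ip B x x - (B k k)^-1 * ip B x (evec R k) ^+ 2.
    rewrite ipB ipZ; congr (_ - _ * _).
    have -> : ip (v^T *m v) x x = (x *m v^T *m (x *m v^T)^T) 0 0.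
      by rewrite /ip trmx_mul trmxK !mulmxA.
    by rewrite trmx_scalar mxE big_ord1 vE.
  (* The coefficient minimizes [B] along the line through [x] in direction [e_k], and the minimum is
     the value of the Schur complement [C] at [x]. *)
  have := psd_add x (evec R k) (- (B k k)^-1 * ip B x (evec R k)) pB.
  rewrite ip_evec => h; apply: le_trans h _.
  by rewrite le_eqVlt; apply/orP; left; apply/eqP; field.
rewrite leq_eqVlt => /orP[/eqP e|ni].
  have -> : i = k by exact: val_inj.
  by rewrite CE mulrA mulVf// mul1r subrr.
by rewrite CE (B0 i) // (BT k i) (B0 i) // mul0r mulr0 subr0.
Qed.

Lemma psd_gram (X : 'I_m -> 'M[R]_m) G H : psd G -> psd H -> psd (gram X G H).
Proof.
move=> pG pH; split; first by rewrite tr_gram ?pG.1 ?pH.1.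
by move=> x; rewrite ip_gram psd_mxtrace_ge0//; exact: psd_congr.
Qed.

Lemma metric_unit G : is_metric G -> G \in unitmx.
Proof.
move=> [_ Gp]; rewrite -row_free_unit; apply: inj_row_free => v vG.
apply/eqP; apply: contraT => /Gp.
by rewrite /ip vG mul0mx mxE ltxx.
Qed.

Lemma psd_inv G : is_metric G -> psd (invmx G).
Proof.
move=> Gm; have pG := psd_metric Gm; have Gu := metric_unit Gm.
have := psd_congr (invmx G) pG.
by rewrite trmx_inv pG.1 mulVmx// mul1mx.
Qed.

Lemma metric_dominates G Z : is_metric G -> Z^T = Z ->
  (forall x, 0 <= ip (Z - G) x x) -> is_metric Z.
Proof.
move=> [_ Gp] ZT le; split=> // x x0.
by apply: lt_le_trans (Gp x x0) _; rewrite -subr_ge0 -ipB.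
Qed.

(** For [x = e_k Z^-1] and [w = e_k G^-1], expanding [0 <= G(x - w, x - w)] and using
    [G(x,x) <= Z(x,x)] gives [Z^-1 <= G^-1] on the diagonal. Off the diagonal, semidefiniteness
    bounds an entry by the mean of two diagonal ones. *)
Lemma dominates_inv_bound G Z i j : is_metric G -> Z^T = Z ->
  (forall x, 0 <= ip (Z - G) x x) -> `|invmx Z i j| <= \tr (invmx G).
Proof.
move=> Gm ZT le; have Zm := metric_dominates Gm ZT le.
have pY := psd_inv Zm; have Zu := metric_unit Zm; have Gu := metric_unit Gm.
have pG := psd_metric Gm; have pH := psd_inv Gm.
have diag k : invmx Z k k <= invmx G k k.
  pose x := evec R k *m invmx Z; pose w := evec R k *m invmx G.
  have e1 : ip Z x x = invmx Z k k.
    by rewrite -ip_congr trmx_inv ZT mulVmx// mul1mx ip_evec.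
  have e2 : ip G x w = invmx Z k k.
    rewrite /ip /w trmx_mul trmx_inv pG.1 -(mulmxA x) mulKVmx//.
    by rewrite /x /evec trmx_delta -rowE -colE !mxE.
  have e3 : ip G w w = invmx G k k.
    by rewrite -ip_congr trmx_inv pG.1 mulVmx// mul1mx ip_evec.
  have := psd_add x w (-1) pG; rewrite e2 e3 => h.
  by have := le x; rewrite ipB e1; lra.
have leT k : invmx G k k <= \tr (invmx G).
  rewrite /mxtrace (bigD1 k)//= lerDl sumr_ge0// => l _.
  by rewrite -(ip_evec (invmx G)) pH.2.
have h1 := psd_add (evec R i) (evec R j) 1 pY.
have h2 := psd_add (evec R i) (evec R j) (-1) pY.
rewrite !ip_evec in h1 h2.
have := diag i; have := diag j; have := leT i; have := leT j.
by rewrite ler_norml => ? ? ? ?; apply/andP; split; lra.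
Qed.

(** * Bounded Lipschitz functions of a matrix *)

(** Boundedness is carried along because a product of Lipschitz functions is Lipschitz once both
    factors are bounded. *)
Definition lip_bdd (K : 'M[R]_m -> Prop) (f : 'M[R]_m -> R) : Prop :=
  exists2 b : R, 0 <= b & forall A B (e : R), K A -> K B -> 0 <= e ->
    (forall i j, `|A i j - B i j| <= e) ->
    `|f A| <= b /\ `|f A - f B| <= b * e.

Lemma lip_bdd_cst K (a : R) : lip_bdd K (fun=> a).
Proof.
by exists `|a| => // A B e _ _ e0 _; rewrite subrr normr0 mulr_ge0.
Qed.

Lemma lip_bddD K f g : lip_bdd K f -> lip_bdd K g -> lip_bdd K (fun A => f A + g A).
Proof.
move=> [b b0 hf] [d d0 hg]; exists (b + d); first exact: addr_ge0.
move=> A B e KA KB e0 AB; have [f1 f2] := hf A B e KA KB e0 AB.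
have [g1 g2] := hg A B e KA KB e0 AB; split.
  exact: le_trans (ler_normD _ _) (lerD f1 g1).
by rewrite opprD addrACA mulrDl (le_trans (ler_normD _ _))// lerD.
Qed.

Lemma lip_bddM K f g : lip_bdd K f -> lip_bdd K g -> lip_bdd K (fun A => f A * g A).
Proof.
move=> [b b0 hf] [d d0 hg]; exists (2 * (b * d)); first by rewrite !mulr_ge0.
move=> A B e KA KB e0 AB; have [f1 f2] := hf A B e KA KB e0 AB.
have [g1 g2] := hg A B e KA KB e0 AB.
have BA i j : `|B i j - A i j| <= e by rewrite distrC.
have [g3 _] := hg B A e KB KA e0 BA; split.
  rewrite normrM; apply: le_trans (ler_pM _ _ f1 g1) _ => //.
  by rewrite ler_peMl ?mulr_ge0// ler1n.
have -> : f A * g A - f B * g B = f A * (g A - g B) + (f A - f B) * g B by ring.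
apply: le_trans (ler_normD _ _) _; rewrite !normrM.
have h1 : `|f A| * `|g A - g B| <= b * (d * e) by exact: ler_pM.
have h2 : `|f A - f B| * `|g B| <= b * e * d by exact: ler_pM.
apply: le_trans (lerD h1 h2) _.
by rewrite le_eqVlt; apply/orP; left; apply/eqP; ring.
Qed.

Lemma lip_bdd_sum K (I : finType) (f : I -> 'M[R]_m -> R) :
  (forall i, lip_bdd K (f i)) -> lip_bdd K (fun A => \sum_i f i A).
Proof.
move=> hf; elim: (index_enum I) => [|i s IH].
  have -> : (fun A => \sum_(i <- [::]) f i A) = fun=> 0.
    by apply/funext => A; rewrite big_nil.
  exact: lip_bdd_cst.
have -> : (fun A => \sum_(j <- i :: s) f j A) =
    fun A => f i A + \sum_(j <- s) f j A.
  by apply/funext => A; rewrite big_cons.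
exact: lip_bddD.
Qed.

Definition lip_bdd_mx (K : 'M[R]_m -> Prop) (f : 'M[R]_m -> 'M[R]_m) : Prop :=
  forall i j, lip_bdd K (fun A => f A i j).

Lemma lip_bdd_mx_cst K C : lip_bdd_mx K (fun=> C).
Proof. by move=> i j; exact: lip_bdd_cst. Qed.

Lemma lip_bdd_mxD K f g : lip_bdd_mx K f -> lip_bdd_mx K g ->
  lip_bdd_mx K (fun A => f A + g A).
Proof.
move=> hf hg i j.
have -> : (fun A => (f A + g A) i j) = fun A => f A i j + g A i j.
  by apply/funext => A; rewrite mxE.
exact: lip_bddD.
Qed.

Lemma lip_bdd_mxZ K a f : lip_bdd_mx K f -> lip_bdd_mx K (fun A => a *: f A).
Proof.
move=> hf i j.
have -> : (fun A => (a *: f A) i j) = fun A => a * f A i j.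
  by apply/funext => A; rewrite mxE.
by apply: lip_bddM => //; exact: lip_bdd_cst.
Qed.

Lemma lip_bdd_mxM K f g : lip_bdd_mx K f -> lip_bdd_mx K g ->
  lip_bdd_mx K (fun A => f A *m g A).
Proof.
move=> hf hg i j.
have -> : (fun A => (f A *m g A) i j) = fun A => \sum_k f A i k * g A k j.
  by apply/funext => A; rewrite mxE.
by apply: lip_bdd_sum => k; exact: lip_bddM.
Qed.

Lemma lip_bdd_mx_gram K X f g : lip_bdd_mx K f -> lip_bdd_mx K g ->
  lip_bdd_mx K (fun A => gram X (f A) (g A)).
Proof.
move=> hf hg k l.
have -> : (fun A => gram X (f A) (g A) k l) =
    fun A => \sum_i (X k *m f A *m (X l)^T *m g A) i i.
  by apply/funext => A; rewrite mxE.
apply: lip_bdd_sum => i.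
have h C : lip_bdd_mx K (fun=> C) by exact: lip_bdd_mx_cst.
by have := lip_bdd_mxM (lip_bdd_mxM (lip_bdd_mxM (h (X k)) hf) (h (X l)^T)) hg;
  apply.
Qed.

(** By [A^-1 - B^-1 = A^-1 (B - A) B^-1], a uniform bound on the inverse is also a Lipschitz bound,
    of order [b ^+ 2]. *)
Lemma lip_bdd_mx_inv (K : 'M[R]_m -> Prop) (b : R) :
  (forall Z, K Z -> Z \in unitmx) ->
  (forall Z i j, K Z -> `|invmx Z i j| <= b) -> lip_bdd_mx K (fun Z => invmx Z).
Proof.
move=> Ku Kb i j; exists (`|b| + \sum_(k < m) \sum_(l < m) b ^+ 2).
  by rewrite addr_ge0// sumr_ge0// => k _; rewrite sumr_ge0// => l _; exact: sqr_ge0.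
have s0 : 0 <= \sum_(k < m) \sum_(l < m) b ^+ 2.
  by rewrite sumr_ge0// => k _; rewrite sumr_ge0// => l _; exact: sqr_ge0.
move=> A B e KA KB e0 AB; split.
  by apply: (le_trans (Kb _ i j KA)); rewrite (le_trans (ler_norm b))// lerDl.
rewrite mulrDl (@le_trans _ _ ((\sum_(k < m) \sum_(l < m) b ^+ 2) * e))//; last first.
  by rewrite lerDr mulr_ge0.
have -> : invmx A i j - invmx B i j = (invmx A *m (B - A) *m invmx B) i j.
  rewrite mulmxBr mulmxBl mulVmx ?Ku// mul1mx mulmxK ?Ku//.
  by rewrite !mxE.
rewrite mxE big_distrl /= (le_trans (ler_norm_sum _ _ _))// ler_sum// => l _.
rewrite mxE normrM big_distrl /=.
have -> : \sum_(i0 < m) b ^+ 2 * e = (\sum_(i0 < m) b * e) * b.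
  by rewrite big_distrl /=; apply: eq_bigr => ? _; ring.
apply: ler_pM => //; last exact: Kb.
rewrite (le_trans (ler_norm_sum _ _ _))// ler_sum// => k _.
rewrite normrM; apply: ler_pM => //; first exact: Kb.
by rewrite !mxE distrC.
Qed.

Lemma lip_bdd_mx_uniform K f : lip_bdd_mx K f -> exists2 b : R, 0 <= b &
  forall i j A B (e : R), K A -> K B -> 0 <= e ->
    (forall i j, `|A i j - B i j| <= e) ->
    `|f A i j| <= b /\ `|f A i j - f B i j| <= b * e.
Proof.
move=> hf.
have /choice[g hg] : forall p : 'I_m * 'I_m, exists b : R, 0 <= b /\
    forall A B (e : R), K A -> K B -> 0 <= e ->
    (forall i j, `|A i j - B i j| <= e) ->
    `|f A p.1 p.2| <= b /\ `|f A p.1 p.2 - f B p.1 p.2| <= b * e.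
  by move=> [i j]; have [b b0 hb] := hf i j; exists b.
have g0 p : 0 <= g p by have [] := hg p.
exists (\sum_p g p); first by rewrite sumr_ge0.
move=> i j A B e KA KB e0 AB; have [_ h] := hg (i, j).
have [h1 h2] := h A B e KA KB e0 AB.
have le : g (i, j) <= \sum_p g p by rewrite (bigD1 (i, j))//= lerDl sumr_ge0.
by split; [exact: le_trans le|apply: le_trans h2 _; rewrite ler_wpM2r].
Qed.
End Psd.

(** * Orthogonal projection onto the derived algebra *)

Section Projector.
Context (R : realType) (m : nat) (c : 'I_m -> 'I_m -> 'rV[R]_m) (J G : 'M[R]_m).

Definition derived_mx : 'M[R]_m := (\sum_i \sum_j <<c i j>>)%MS.

Lemma sub_derived_mx i j : (c i j <= derived_mx)%MS.
Proof.
apply: submx_trans (sumsmx_sup i _ (submx_refl _)) => //.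
by apply: (sumsmx_sup j) => //; rewrite genmxE.
Qed.

Lemma derived_mx_sub n (B : 'M[R]_(n, m)) :
  (forall i j, (c i j <= B)%MS) -> (derived_mx <= B)%MS.
Proof.
move=> cB; apply/sumsmx_subP => i _; apply/sumsmx_subP => j _.
by rewrite genmxE.
Qed.

Lemma in_derived_sub v : in_derived c v -> (v <= derived_mx)%MS.
Proof.
move=> [s ->]; rewrite big_seq; apply: summx_sub => p _.
apply: summx_sub => i _; apply: summx_sub => j _.
exact/scalemx_sub/sub_derived_mx.
Qed.

Lemma hermitian_congr : hermitian_metric J G -> J *m G *m J^T = G.
Proof. by move=> [_ h]; apply: ip_ext => x y; rewrite ip_congr. Qed.

Lemma skew_mul : J *m J = - 1%:M -> J *m G *m J^T = G -> G *m J^T = - (J *m G).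
Proof.
move=> JJ e; rewrite -{2}e !mulmxA JJ !mulNmx mul1mx.
by rewrite opprK.
Qed.

(** With [B] a basis of the derived algebra, the projection is [G B^T (B G B^T)^-1 B]; the Gram
    matrix in the middle is invertible because [G] is definite. *)
Lemma derived_projector :
  (forall x y z, br c (br c x y) z = 0) -> J *m J = - 1%:M ->
  J_preserves_commutators c J -> hermitian_metric J G ->
  exists P : 'M[R]_m,
    [/\ P *m P = P, forall i j, c i j *m P = c i j,
        forall k, P *m adk c k = 0,
        P *m G = G *m P^T & P *m J = J *m P].
Proof.
move=> nil JJ Jc Gh; have Gm := Gh.1; have GT := Gm.1.
have GJ := skew_mul JJ (hermitian_congr Gh).
pose V := derived_mx.
have VJ : (V *m J <= V)%MS.
  have h : (V <= V *m (- J))%MS.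
    apply: derived_mx_sub => i j.
    have -> : c i j = c i j *m J *m (- J).
      by rewrite mulmxN -mulmxA JJ mulmxN mulmx1 opprK.
    apply/submxMr/in_derived_sub/Jc.
    exists [:: (evec R i, evec R j)].
    by rewrite big_seq1 /= br_evec.
  by have := submxMr J h; rewrite -mulmxA mulNmx JJ opprK mulmx1.
pose r := \rank V; pose B : 'M[R]_(r, m) := row_base V.
have BV : (B :=: V)%MS by exact: eq_row_base.
have Bfree : row_free B by exact: row_base_free.
clearbody B.
have Mu : B *m G *m B^T \in unitmx.
  rewrite -row_free_unit; apply: inj_row_free => v v0.
  have vB0 : v *m B = 0.
    apply/eqP; apply: contraT => /(Gm.2); rewrite /ip trmx_mul.
    have -> : v *m B *m G *m (B^T *m v^T) = v *m (B *m G *m B^T) *m v^T.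
      by rewrite !mulmxA.
    by rewrite v0 mul0mx mxE ltxx.
  by apply: (row_free_inj Bfree); rewrite vB0 mul0mx.
pose M := invmx (B *m G *m B^T).
have MT : M^T = M by rewrite trmx_inv !trmx_mul trmxK GT mulmxA.
pose P := G *m B^T *m M *m B.
have PE : P = (G *m B^T *m M) *m B by [].
clearbody P.
have BP : B *m P = B by rewrite PE !mulmxA mulmxV// mul1mx.
have subP n (u : 'M[R]_(n, m)) : (u <= V)%MS -> u *m P = u.
  by rewrite -BV => /submxP[D ->]; rewrite -mulmxA BP.
have PG : P *m G = G *m P^T.
  by rewrite PE !trmx_mul trmxK MT GT !mulmxA.
have PJP : P *m J *m P = P *m J.
  have BJ : B *m J *m P = B *m J.
    by apply: subP; apply: submx_trans VJ; apply: submxMr; rewrite BV.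
  by rewrite {1 3}PE -!mulmxA (mulmxA B) BJ.
exists P; split=> //.
- by rewrite {1}[P]PE -mulmxA BP.
- by move=> i j; apply/subP/sub_derived_mx.
- move=> k; rewrite PE -mulmxA; suff -> : B *m adk c k = 0 by rewrite mulmx0.
  apply/sub_kermxP; rewrite BV; apply: derived_mx_sub => i j.
  apply/sub_kermxP; rewrite -br_evec -(comb_evec (adk c) k) -br_comb.
  exact: nil.
(* Stability of V under [J] gave [P J P = P J]. Taking [G]-adjoints, with [P] self-adjoint and [J]
   skew, turns it into [P J P = J P]. *)
- have Gu := metric_unit Gm.
  have l : G *m (P *m J *m P)^T = - (P *m J *m P *m G).
    rewrite !trmx_mul !mulmxA -PG -(mulmxA P G) GJ mulmxN mulNmx.
    by rewrite -!mulmxA -PG.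
  have r' : G *m (P *m J)^T = - (J *m P *m G).
    by rewrite trmx_mul mulmxA GJ mulNmx -!mulmxA -PG.
  move: l; rewrite PJP r' => /oppr_inj/(can_inj (mulmxK Gu)) ->.
  by [].
Qed.
End Projector.

(** * Limits and derivatives of matrix curves *)

Lemma cvg_finsum (R : realType) (T : Type) (F : set_system T) {FF : Filter F}
    (I : finType) (f : I -> T -> R) (l : I -> R) :
  (forall i, f i x @[x --> F] --> l i) ->
  \sum_i f i x @[x --> F] --> \sum_i l i.
Proof. by move=> fl; apply: cvg_big => // -[a b]; exact: add_continuous. Qed.

Lemma cvg_ip (R : realType) (m : nat) (T : Type) (F : set_system T) {FF : Filter F}
    (A : T -> 'M[R]_m) (L : 'M[R]_m) (x y : 'rV[R]_m) :
  (forall i j, A h i j @[h --> F] --> L i j) ->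
  ip (A h) x y @[h --> F] --> ip L x y.
Proof.
move=> AL; rewrite ip_sum; under eq_fun do rewrite ip_sum.
apply: cvg_finsum => i; apply: cvg_finsum => j.
apply: cvgM; last exact: cvg_cst.
by apply: cvgM; [exact: cvg_cst|exact: AL].
Qed.

Lemma is_derive_ip (R : realType) (m : nat) (Z : R -> 'M[R]_m) (dZ : 'M[R]_m)
    (t : R) (x y : 'rV[R]_m) :
  (forall i j, is_derive t 1 (fun s : R => Z s i j) (dZ i j)) ->
  is_derive t 1 (fun s : R => ip (Z s) x y) (ip dZ x y).
Proof.
move=> dZt; rewrite ip_sum.
have -> : (fun s : R => ip (Z s) x y) =
    \sum_i \sum_j (x 0 i * y 0 j) *: (fun s : R => Z s i j).
  apply/funext => s; rewrite ip_sum fct_sumE; apply: eq_bigr => i _.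
  by rewrite fct_sumE; apply: eq_bigr => j _; rewrite mulrAC.
apply: is_derive_sum => i; apply: is_derive_sum => j.
by rewrite mulrAC; exact: is_deriveZ.
Qed.

Lemma cvg_mulmx (R : realType) (m : nat) (T : Type) (F : set_system T)
    {FF : Filter F} (A B : T -> 'M[R]_m) (LA LB : 'M[R]_m) :
  (forall i j, A h i j @[h --> F] --> LA i j) ->
  (forall i j, B h i j @[h --> F] --> LB i j) ->
  forall i j, (A h *m B h) i j @[h --> F] --> (LA *m LB) i j.
Proof.
move=> cA cB i j; rewrite mxE; under eq_fun do rewrite mxE.
by apply: cvg_finsum => k; apply: cvgM; [exact: cA|exact: cB].
Qed.

Lemma is_deriveP (R : realType) (f : R -> R) (t df : R) :
  is_derive t 1 f df <->
  (fun h : R => h^-1 * (f (t + h) - f t)) @ (0 : R)^' --> df.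
Proof.
have -> : (fun h : R => h^-1 * (f (t + h) - f t)) =
    (fun h : R => h^-1 *: ((f \o shift t) (h *: (1 : R)) - f t)).
  by apply/funext => h /=; rewrite [h *: 1]mulr1 (addrC t).
split=> [[d <-]|d]; first exact: d.
by split; [exact: cvgP d|exact: cvg_lim d].
Qed.

Lemma cvg_shift (R : realType) (t : R) (H : set_system R) {FH : Filter H} :
  H `=>` (0 : R)^' -> t + h @[h --> H] --> t.
Proof.
move=> H0; have H1 : H `=>` nbhs (0 : R) by exact: cvg_trans H0 (cvg_within _).
by rewrite -[X in _ --> X]addr0; apply: cvgD; [exact: cvg_cst|exact: H1].
Qed.


Lemma is_derive_const_eq (R : realType) (f : R -> R) :
  (forall t : R, 0 <= t -> is_derive t 1 f 0) ->
  forall t : R, 0 <= t -> f t = f 0.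
Proof.
move=> d t t0; apply/eqP; rewrite -subr_eq0 -normr_le0.
have := @is_derive_norm_le R f (fun=> 0) (cst 0) (fun=> 0) 0 t d.
by rewrite subrr; apply=> // s _; rewrite normr0.
Qed.

(** * The flow in the monotone variable *)

Section Flow.
Context (R : realType) (m : nat) (c : 'I_m -> 'I_m -> 'rV[R]_m).
Context (J G0 P : 'M[R]_m).
Hypothesis anti : forall x y, br c x y = - br c y x.
Hypothesis nil : forall x y z, br c (br c x y) z = 0.
Hypothesis JJ : J *m J = - 1%:M.
Hypothesis G0h : hermitian_metric J G0.
Hypothesis PP : P *m P = P.
Hypothesis cP : forall i j, c i j *m P = c i j.
Hypothesis Padk : forall k, P *m adk c k = 0.
Hypothesis PG0 : P *m G0 = G0 *m P^T.
Hypothesis PJ : P *m J = J *m P.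

Local Notation Q := (1%:M - P).
Implicit Types (x y : 'rV[R]_m) (Z : 'M[R]_m).

(* [P] is the [G0]-orthogonal projection onto the derived algebra. *)
Definition flow_domain Z : Prop :=
  [/\ forall x y, ip Z x y = ip Z y x,
      forall x y, ip Z (x *m P) y = ip Z x (y *m P),
      forall x y, ip Z (x *m J) (y *m J) = ip Z x y &
      forall x, ip G0 x x <= ip Z x x].

(** On V, [Z] is [G0 h^-1 G0], so [G0 *m invmx Z *m G0] is the actual metric [h] there. Brackets
    take values in V, which is why it stands in the first slot. *)
Definition flow_S Z := gram (adk c) (G0 *m invmx Z *m G0) (invmx Z).
Definition flow_T Z := gram (coadk c) (invmx Z) (invmx Z).

(** The first summand lives on W and is [k']. The second lives on V: it is [- G0 h^-1 h' h^-1 G0]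
    with [h' = - h (T + J^T T J) h / 8], where [h] cancels. *)
Definition flow_field Z : 'M[R]_m :=
  4^-1 *: (flow_S Z + J *m flow_S Z *m J^T) +
  8^-1 *: (G0 *m (flow_T Z + J^T *m flow_T Z *m J) *m G0).

(* [Z] carries the metric on the complement [W] of the derived algebra [V], and
   on [V] the inverse of the metric, turned into a form on [V] by [G0]. *)
Definition flow_metric Z : 'M[R]_m := Q *m Z + P *m G0 *m invmx Z *m G0.

Let G0m : is_metric G0 := G0h.1.
Let G0T : G0^T = G0 := G0h.1.1.
Let G0u : G0 \in unitmx := metric_unit G0m.
Let G0J : G0 *m J^T = - (J *m G0) := skew_mul JJ (hermitian_congr G0h).
Let JG0 : J *m G0 = - (G0 *m J^T).
Proof. by rewrite G0J opprK. Qed.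

Let QP : Q *m P = 0. Proof. by rewrite mulmxBl mul1mx PP subrr. Qed.
Let PQ : P *m Q = 0. Proof. by rewrite mulmxBr mulmx1 PP subrr. Qed.
Let PTJT : P^T *m J^T = J^T *m P^T.
Proof. by rewrite -!trmx_mul PJ. Qed.
Let JTJT : J^T *m J^T = - 1%:M.
Proof. by rewrite -trmx_mul JJ linearN /= trmx1. Qed.

Let adkP k : adk c k *m P = adk c k.
Proof. by apply/row_matrixP => i; rewrite row_mul rowK cP. Qed.

Let Pcoadk k : P *m coadk c k = 0.
Proof.
apply/matrixP => i j; rewrite [RHS]mxE.
have <- : (P *m adk c j) i k = 0 by rewrite Padk mxE.
by rewrite !mxE; apply: eq_bigr => l _; rewrite !mxE.
Qed.

Let coadkT k : (coadk c k)^T = - coadk c k.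
Proof. by rewrite -(comb_evec (coadk c) k) tr_coadk. Qed.

(** [flow_domain] is phrased by scalar conditions, which pass to limits and can be differentiated;
    the algebra needs these matrix forms. *)
Lemma flow_domain_mx Z : flow_domain Z ->
  [/\ Z^T = Z, P *m Z = Z *m P^T & J *m Z *m J^T = Z].
Proof.
move=> [s p j _]; split; apply: ip_ext => x y.
- by rewrite ip_tr s.
- have := p x y; rewrite /ip trmx_mul !mulmxA => <-.
  by [].
- by rewrite ip_congr j.
Qed.

Lemma mx_flow_domain Z : Z^T = Z -> P *m Z = Z *m P^T -> J *m Z *m J^T = Z ->
  (forall x, ip G0 x x <= ip Z x x) -> flow_domain Z.
Proof.
move=> s p j le; split=> // x y.
- by rewrite -{1}s ip_tr.
- have -> : ip Z (x *m P) y = ip (P *m Z) x y by rewrite /ip !mulmxA.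
  by rewrite p /ip trmx_mul !mulmxA.
- by rewrite -ip_congr j.
Qed.

Lemma flow_domain0 : flow_domain G0.
Proof. exact: mx_flow_domain G0T PG0 (hermitian_congr G0h) _. Qed.

Lemma flow_domain_dominates Z : flow_domain Z ->
  forall x, 0 <= ip (Z - G0) x x.
Proof. by move=> [_ _ _ le] x; rewrite ipB subr_ge0. Qed.

Lemma flow_domain_metric Z : flow_domain Z -> is_metric Z.
Proof.
move=> KZ; have [ZT _ _] := flow_domain_mx KZ.
exact: metric_dominates G0m ZT (flow_domain_dominates KZ).
Qed.

Lemma psd_flow_field Z : flow_domain Z -> psd (flow_field Z).
Proof.
move=> KZ; have pY := psd_inv (flow_domain_metric KZ).
have pS : psd (flow_S Z).
  by apply: psd_gram => //; rewrite -{2}G0T; exact: psd_congr.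
have pT : psd (flow_T Z) by exact: psd_gram.
apply: psdD; apply: psdZ; rewrite ?invr_ge0//.
  by apply: psdD => //; exact: psd_congr.
rewrite -{2}G0T; apply: psd_congr; apply: psdD => //.
by rewrite -{2}[J]trmxK; exact: psd_congr.
Qed.

(** * The field and the recovered metric at a fixed time *)

Section FlowAt.
Context (Z : 'M[R]_m).
Hypothesis KZ : flow_domain Z.
Local Notation Y := (invmx Z).
Local Notation W := (G0 *m Y *m G0).
Local Notation S := (flow_S Z).
Local Notation T := (flow_T Z).
Local Notation S2 := (S + J *m S *m J^T).
Local Notation T2 := (T + J^T *m T *m J).

Let Zm : is_metric Z := flow_domain_metric KZ.
Let Zu : Z \in unitmx := metric_unit Zm.
Let ZT : Z^T = Z. Proof. by have [] := flow_domain_mx KZ. Qed.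
Let PZ : P *m Z = Z *m P^T. Proof. by have [] := flow_domain_mx KZ. Qed.
Let ZJ : Z *m J^T = - (J *m Z).
Proof. by apply: skew_mul => //; have [] := flow_domain_mx KZ. Qed.
Let YT : Y^T = Y. Proof. by rewrite trmx_inv ZT. Qed.
Let PTY : P^T *m Y = Y *m P.
Proof.
rewrite -[P^T](mulKmx Zu) -PZ -!mulmxA mulmxV// mulmx1.
by [].
Qed.
Let JTY : J^T *m Y = - (Y *m J).
Proof.
by rewrite -[J^T](mulKmx Zu) ZJ mulmxN mulNmx -!mulmxA mulmxV// mulmx1.
Qed.
Let PW : P *m W = W *m P^T.
Proof. by rewrite !mulmxA PG0 -(mulmxA G0) PTY -!mulmxA PG0. Qed.
Let WJ : W *m J^T = - (J *m W).
Proof.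
rewrite -(mulmxA _ G0) G0J mulmxN !mulmxA -(mulmxA G0 Y) .
have -> : Y *m J = - (J^T *m Y) by rewrite JTY opprK.
by rewrite mulmxN mulmxA G0J !mulNmx opprK.
Qed.

(** The derived algebra is central, so [ad] vanishes on it. *)
Let PS : P *m S = 0.
Proof.
apply: comb_eq0_gram => x; apply/row_matrixP => i.
rewrite row0 rowE -br_comb anti br_comb -mulmxA.
have -> : P *m comb (adk c) (delta_mx 0 i) = 0 by rewrite [comb _ _]comb_evec Padk.
by rewrite mulmx0 oppr0.
Qed.

Let pY : psd Y := psd_inv Zm.
Let TT : T^T = T. Proof. exact: tr_gram. Qed.

(** Brackets have no component along W, so [T] vanishes on covectors that kill V. *)
Let QTT : Q^T *m T = 0.
Proof.
apply: comb_eq0_gram => x; apply: ip_ext => u v.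
rewrite ip_coadk trmx_mul trmxK mulmxA.
have -> : br c u v *m Q = 0.
  rewrite br_comb -mulmxA.
  suff -> : comb (adk c) v *m Q = 0 by rewrite mulmx0.
  rewrite mulmxBr mulmx1 /comb mulmx_suml; apply/eqP; rewrite subr_eq0; apply/eqP.
  by apply: eq_bigr => k _; rewrite -scalemxAl adkP.
by rewrite mul0mx /ip mulmx0 mul0mx.
Qed.

Let PTT : P^T *m T = T.
Proof.
move: QTT; rewrite linearB /= trmx1 mulmxBl mul1mx => /eqP.
by rewrite subr_eq0 => /eqP <-.
Qed.

Let PS2 : P *m S2 = 0.
Proof. by rewrite mulmxDr !mulmxA PJ -(mulmxA J) PS mulmx0 mul0mx addr0. Qed.

Let PTT2 : P^T *m T2 = T2.
Proof. by rewrite mulmxDr !mulmxA PTJT -(mulmxA J^T) PTT. Qed.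

Let T2T : T2^T = T2.
Proof. by rewrite linearD /= !trmx_mul trmxK TT mulmxA. Qed.

Let T2P : T2 *m P = T2.
Proof. by apply: trmx_inj; rewrite trmx_mul T2T PTT2. Qed.

Let PF : P *m flow_field Z = 8^-1 *: (G0 *m T2 *m G0).
Proof.
rewrite /flow_field mulmxDr -!scalemxAr PS2 scaler0 add0r !mulmxA PG0.
by rewrite -(mulmxA G0 P^T) PTT2.
Qed.

Lemma flow_field_block : P *m flow_field Z = flow_field Z *m P^T.
Proof.
have FT := (psd_flow_field KZ).1.
rewrite -{2}FT -trmx_mul PF linearZ /= !trmx_mul T2T G0T.
by rewrite !mulmxA.
Qed.

Lemma flow_field_J : J *m flow_field Z *m J^T = flow_field Z.
Proof.
rewrite /flow_field mulmxDr mulmxDl -!scalemxAr -!scalemxAl; congr (_ *: _ + _ *: _).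
  rewrite mulmxDr mulmxDl !mulmxA JJ -(mulmxA _ J^T) JTJT mulNmx mul1mx.
  by rewrite mulmxN mulNmx opprK mulmx1 addrC.
have -> : J *m (G0 *m T2 *m G0) *m J^T = G0 *m (J^T *m T2 *m J) *m G0.
  by rewrite !mulmxA JG0 -(mulmxA _ G0 J^T) G0J !(mulNmx, mulmxN) opprK !mulmxA.
congr (_ *m _ *m _).
rewrite mulmxDr mulmxDl !mulmxA JTJT -(mulmxA _ J) JJ mulNmx mul1mx.
by rewrite mulmxN mulNmx opprK mulmx1 addrC.
Qed.

Local Notation G := (flow_metric Z).
Let W' := invmx G0 *m Z *m invmx G0.
Let GE : G = Q *m Z + P *m W.
Proof. by rewrite /flow_metric !mulmxA. Qed.

Let QZ : Q *m Z = Z *m Q^T.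
Proof. by rewrite linearB /= trmx1 mulmxBl mulmxBr mulmx1 mul1mx PZ. Qed.

Let PQT : P^T *m Q^T = 0. Proof. by rewrite -trmx_mul QP trmx0. Qed.
Let QPT : Q^T *m P^T = 0. Proof. by rewrite -trmx_mul PQ trmx0. Qed.
Let PPT : P^T *m P^T = P^T. Proof. by rewrite -trmx_mul PP. Qed.
Let QQT : Q^T *m Q^T = Q^T.
Proof. by rewrite {1}linearB /= trmx1 mulmxBl mul1mx PQT subr0. Qed.

Lemma flow_metric_ip x : ip G x x =
  ip Z (x *m Q) (x *m Q) + ip Y (x *m P *m G0) (x *m P *m G0).
Proof.
rewrite GE ipD; congr (_ + _).
  by rewrite -ip_congr -mulmxA -QZ mulmxA -mulmxA -/Q mulmxA
     mulmxBr mulmx1 QP subr0.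
rewrite -(mulmxA x P) -ip_congr trmx_mul G0T; congr (ip _ x x).
by rewrite -{1}PP -mulmxA PW !mulmxA.
Qed.

Lemma flow_metric_metric : is_metric G.
Proof.
split.
  have WT : W^T = W by rewrite !trmx_mul YT G0T mulmxA.
  by rewrite GE linearD /= trmx_mul ZT -QZ trmx_mul WT PW.
move=> x x0; rewrite flow_metric_ip.
have [xP|xP] := eqVneq (x *m P) 0.
  rewrite xP !mul0mx {2}/ip mul0mx mul0mx mxE addr0 mulmxBr mulmx1 xP subr0.
  exact: Zm.2.
apply: ltr_wpDl; first by have := (psd_metric Zm).2.
have -> : ip Y (x *m P *m G0) (x *m P *m G0) = 
   ip Z (x *m P *m G0 *m Y) (x *m P *m G0 *m Y).
  by rewrite -[RHS]ip_congr YT mulVmx// mul1mx.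
apply: Zm.2; apply: contra xP => /eqP h; apply/eqP.
have Yu : Y \in unitmx by rewrite unitmx_inv.
by rewrite -[x *m P](mulmxK G0u) -[_ *m G0](mulmxK Yu) h !mul0mx.
Qed.

(** Inversion is blockwise: [Z^-1] on W, and on V the matrix [W'], inverse to [G0 *m Y *m G0]. *)
Lemma invmx_flow_metric : invmx G = Q^T *m Y + P^T *m W'.
Proof.
have Gu := metric_unit flow_metric_metric.
have e : G *m (Q^T *m Y + P^T *m W') = 1%:M.
  rewrite GE mulmxDr !(mulmxDl (Q *m Z) (P *m W)).
  have -> : Q *m Z *m (Q^T *m Y) = Q.
    by rewrite QZ mulmxA -(mulmxA Z) QQT -QZ mulmxK.
  have -> : P *m W *m (Q^T *m Y) = 0.
    by rewrite PW mulmxA -(mulmxA W) PQT mulmx0 mul0mx.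
  have -> : Q *m Z *m (P^T *m W') = 0.
    by rewrite QZ mulmxA -(mulmxA Z) QPT mulmx0 mul0mx.
  have -> : P *m W *m (P^T *m W') = P.
    rewrite PW mulmxA -(mulmxA W) PPT -PW -mulmxA.
    suff -> : W *m W' = 1%:M by rewrite mulmx1.
    by rewrite /W' !mulmxA (mulmxK G0u) (mulmxKV Zu) mulmxV.
  by rewrite addr0 add0r subrK.
by rewrite -[RHS](mulKmx Gu) e mulmx1.
Qed.

(** Brackets land in V, where the metric is [G0 *m Y *m G0], and vanish on V, so only the W-block
    [Y] of the inverse metric is seen. *)
Lemma flow_metric_gram_adk : gram (adk c) G (invmx G) = S.
Proof.
rewrite invmx_flow_metric; apply: eq_gram => k l; congr (_ *m _).
  rewrite GE mulmxDr !mulmxA adkP mulmxBr mulmx1 adkP subrr !mul0mx.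
  by rewrite add0r.
have e : (adk c l)^T *m P^T = 0 by rewrite -trmx_mul Padk trmx0.
by rewrite mulmxDr !mulmxA e !mul0mx addr0 linearB /= trmx1 mulmxBr e subr0 mulmx1.
Qed.

Lemma flow_metric_gram_coadk : gram (coadk c) (invmx G) (invmx G) = T.
Proof.
have e k : coadk c k *m invmx G = coadk c k *m Y.
  have e : coadk c k *m P^T = 0.
    by rewrite -[coadk c k]opprK -coadkT mulNmx -trmx_mul Pcoadk trmx0 oppr0.
  rewrite invmx_flow_metric mulmxDr !mulmxA e !mul0mx addr0.
  by rewrite linearB /= trmx1 mulmxBr e subr0 mulmx1.
apply: eq_gram => k l; congr (_ *m _) => //.
by rewrite coadkT !mulNmx e.
Qed.

Lemma flow_metric_J : J *m G = - (G *m J^T).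
Proof.
rewrite GE (mulmxDl (Q *m Z)) (mulmxDr J (Q *m Z)) -(mulmxA Q) -(mulmxA P) ZJ WJ !mulmxN opprD !opprK.
have JQ : J *m Q = Q *m J by rewrite mulmxBr mulmxBl mulmx1 mul1mx PJ.
by rewrite (mulmxA J) (mulmxA J P) -PJ JQ !mulmxA.
Qed.

(** The form inside [ip] is the derivative of [flow_metric] at [Z] in direction [flow_field Z], the
    inverse contributing [- Y F Y]. This is the flow equation before any limit is taken. *)
Lemma flow_metric_ricci11 x y : ricci11 c J G x y =
  - ip (Q *m flow_field Z - P *m G0 *m Y *m flow_field Z *m Y *m G0) x y.
Proof.
have [GT _] := flow_metric_metric; have Gu := metric_unit flow_metric_metric.
rewrite /ricci11 !(ricci_gram anti nil GT Gu) flow_metric_gram_adk flow_metric_gram_coadk.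
rewrite -!(ip_congr J).
have -> : J *m (G *m T *m G) *m J^T = G *m (J^T *m T *m J) *m G.
  rewrite !mulmxA flow_metric_J -[_ *m G *m J^T]mulmxA.
  have -> : G *m J^T = - (J *m G) by rewrite flow_metric_J opprK.
  by rewrite !(mulNmx, mulmxN) opprK !mulmxA.
have GPT : G *m P^T = P *m W.
  by rewrite GE (mulmxDl (Q *m Z)) -(mulmxA Q) -PZ mulmxA QP mul0mx add0r -mulmxA -PW mulmxA PP.
have PG : P *m G = P *m W.
  by rewrite GE (mulmxDr P (Q *m Z)) !mulmxA PQ mul0mx add0r PP.
have GTG : G *m T2 *m G = P *m W *m T2 *m W.
  have T2G : T2 *m G = T2 *m W by rewrite -{1}T2P -mulmxA PG mulmxA T2P.
  by rewrite -{1}PTT2 (mulmxA G) GPT -mulmxA T2G mulmxA.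
have e1 : Q *m flow_field Z = 4^-1 *: S2.
  rewrite mulmxBl mul1mx PF /flow_field; exact: addrK.
have e2 : P *m G0 *m Y *m flow_field Z *m Y *m G0 = 8^-1 *: (G *m T2 *m G).
  have -> : P *m G0 *m Y = G0 *m Y *m P by rewrite PG0 -!mulmxA PTY.
  rewrite -(mulmxA _ P) PF -!(scalemxAr, scalemxAl) GTG; congr (_ *: _).
  rewrite PW -(mulmxA _ P^T) PTT2.
  by rewrite !mulmxA.
rewrite e1 e2 ipB !ipZ (mulmxDr G T) (mulmxDl (G *m T)) !ipD.
by field.
Qed.
End FlowAt.

(** * Existence of the flow and return to the metric *)

Local Notation K := flow_domain.
Local Notation F := flow_field.

Lemma flow_domain_closed (u : nat -> 'M[R]_m) (A : 'M[R]_m) :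
  (forall k, K (u k)) ->
  (forall i j, (fun k => u k i j) @ \oo --> A i j) -> K A.
Proof.
move=> Ku uA.
have cu x y : ip (u k) x y @[k --> \oo] --> ip A x y by exact: cvg_ip.
have ext x y x' y' : (forall k, ip (u k) x y = ip (u k) x' y') ->
    ip A x y = ip A x' y'.
  move=> e; have /cvg_lim <- // := cu x y.
  by under eq_fun do rewrite e; exact/cvg_lim.
split=> [x y|x y|x y|x]; try by apply: ext => k; have [] := Ku k.
have /cvg_lim <- // := cu x x; apply: limr_ge; first exact: cvgP (cu x x).
by apply: nearW => k; have [] := Ku k.
Qed.

(** Each linear identity holds for [G0] and for the field, so its defect is constant along [y]; the
    domination of [G0] persists because the field is semidefinite. *)
Lemma flow_domain_invariant (y z : R -> 'M[R]_m) :
  (forall t : R, 0 <= t -> K (z t)) -> y 0 = G0 ->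
  (forall t : R, 0 <= t -> forall i j,
     is_derive t 1 (fun s : R => y s i j) (F (z t) i j)) ->
  forall t : R, 0 <= t -> K (y t).
Proof.
move=> Kz y0 dy t t0.
have dip (s : R) a b : 0 <= s ->
    is_derive s 1 (fun s : R => ip (y s) a b) (ip (F (z s)) a b).
  by move=> s0; apply: is_derive_ip => i j; exact: dy.
have [s0 p0 j0 _] := flow_domain0.
have ext a b a' b' :
    (forall s : R, 0 <= s -> ip (F (z s)) a b = ip (F (z s)) a' b') ->
    ip G0 a b = ip G0 a' b' -> ip (y t) a b = ip (y t) a' b'.
  move=> e e0; apply/eqP; rewrite -subr_eq0.
  have d (s : R) : 0 <= s -> is_derive s 1
      ((fun s : R => ip (y s) a b) - (fun s : R => ip (y s) a' b')) 0.
    move=> sp; rewrite -(subrr (ip (F (z s)) a b)) {2}e//.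
    by apply: is_deriveB; exact: dip.
  by have := is_derive_const_eq d t0; rewrite !fctE y0 e0 subrr => ->.
have FT (s : R) a b : 0 <= s -> ip (F (z s)) a b = ip (F (z s)) b a.
  move=> sp; apply: psd_ip_sym; exact: psd_flow_field (Kz s sp).
split=> [a b|a b|a b|a].
- by apply: ext => // s /FT.
- apply: ext => // s sp.
  have e := flow_field_block (Kz s sp).
  have -> : ip (F (z s)) (a *m P) b = ip (P *m F (z s)) a b.
    by rewrite /ip !mulmxA.
  by rewrite e /ip trmx_mul !mulmxA.
- apply: ext => // s sp.
  by rewrite -ip_congr flow_field_J.
- rewrite -[X in ip X _ _ <= _]y0.
  apply: (@is_derive_nonneg_le R (fun s : R => ip (y s) a a)
    (fun s => ip (F (z s)) a a)) => // s sp.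
  by apply: (psd_flow_field (Kz s sp)).2.
Qed.

Lemma lip_bdd_invmx : lip_bdd_mx K (fun Z => invmx Z).
Proof.
apply: (@lip_bdd_mx_inv _ _ _ (\tr (invmx G0))) => Z.
  by move=> /flow_domain_metric/metric_unit.
move=> i j KZ; have [ZT _ _] := flow_domain_mx KZ.
exact: dominates_inv_bound G0m ZT (flow_domain_dominates KZ).
Qed.

Lemma lip_bdd_flow_field : lip_bdd_mx K F.
Proof.
have h A : lip_bdd_mx K (fun=> A) by exact: lip_bdd_mx_cst.
have hY := lip_bdd_invmx.
have hS : lip_bdd_mx K flow_S.
  apply: lip_bdd_mx_gram => //; apply: lip_bdd_mxM => //.
  exact: lip_bdd_mxM.
have hT : lip_bdd_mx K flow_T by exact: lip_bdd_mx_gram.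
apply: lip_bdd_mxD; apply: lip_bdd_mxZ.
  by apply: lip_bdd_mxD => //; do 2 apply: lip_bdd_mxM => //.
apply: lip_bdd_mxM => //; apply: lip_bdd_mxM => //.
by apply: lip_bdd_mxD => //; do 2 apply: lip_bdd_mxM => //.
Qed.

Lemma flow_exists : exists Z : R -> 'M[R]_m, Z 0 = G0 /\
  forall t : R, 0 <= t -> K (Z t) /\
    forall i j, is_derive t 1 (fun s : R => Z s i j) (F (Z t) i j).
Proof.
have [b b0 hb] := lip_bdd_mx_uniform lip_bdd_flow_field.
have K0 := flow_domain0.
(* The Lipschitz constant must be positive, while [b] may be [0]. *)
apply: (@picard_global R m m K F G0 (b + 1) b) => //.
- by rewrite ltr_wpDl.
- exact: flow_domain_closed.
- move=> A i j KA; have [] // := hb i j A A 0 KA KA (lexx 0).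
  by move=> k l; rewrite subrr normr0.
- move=> A B e KA KB AB i j.
  have e0 : 0 <= e by exact: le_trans (AB i j).
  have [_ h] := hb i j A B e KA KB e0 AB.
  by apply: le_trans h _; rewrite ler_wpM2r// lerDl.
- exact: flow_domain_invariant.
Qed.

Local Notation G := flow_metric.

(** The filter is abstract so that one proof covers right limits at [t >= 0] and two-sided limits at
    [t > 0]. In both cases [t + h] stays nonnegative, where [Z] is in the domain. *)
Lemma flow_metric_cvg (Z : R -> 'M[R]_m) (t : R) (H : set_system R)
    {FH : ProperFilter H} :
  (forall s : R, 0 <= s -> K (Z s)) -> 0 <= t -> H `=>` (0 : R)^' ->
  (\forall h \near H, 0 <= t + h) ->
  (forall i j, is_derive t 1 (fun s : R => Z s i j) (F (Z t) i j)) ->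
  forall i j, (fun h : R => h^-1 * (G (Z (t + h)) i j - G (Z t) i j)) @ H -->
    - ricci11 c J (G (Z t)) (evec R i) (evec R j).
Proof.
move=> KZ t0 H0 Hp dZ i j.
rewrite (flow_metric_ricci11 (KZ t t0)) opprK.
have dq k l : h^-1 * (Z (t + h) k l - Z t k l) @[h --> H] --> F (Z t) k l.
  have /is_deriveP := dZ k l; apply: cvg_trans.
  exact: cvg_app.
have cZ k l : Z (t + h) k l @[h --> H] --> Z t k l.
  apply: (@cvg_comp _ _ _ (fun h => t + h) (fun s => Z s k l) H (nbhs t)).
    exact: cvg_shift.
  have [d _] := dZ k l.
  have /derivable1_diffP := d; exact: differentiable_continuous.
have cY k l : invmx (Z (t + h)) k l @[h --> H] --> invmx (Z t) k l.
  have [b b0 hb] := lip_bdd_invmx k l; have b1 : 0 < b + 1 by rewrite ltr_wpDl.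
  apply/cvgrPdist_le => /= e e0.
  have e1 : 0 < e / (b + 1) by rewrite divr_gt0.
  have near_Z : \forall h \near H, forall p : 'I_m * 'I_m,
      `|Z t p.1 p.2 - Z (t + h) p.1 p.2| <= e / (b + 1).
    by apply: filter_forall => p; have /cvgrPdist_le/(_ _ e1) := cZ p.1 p.2.
  near=> h.
  have Kh : K (Z (t + h)) by apply: KZ; near: h.
  have [|_ le] := hb _ _ _ (KZ t t0) Kh (ltW e1).
    move=> k' l'; rewrite -[k']/(k', l').1 -[l' in X in X <= _]/(k', l').2.
    by move: (k', l'); near: h.
  apply: le_trans le _; rewrite mulrA ler_pdivrMr// mulrC ler_wpM2l ?ltW//.
  by rewrite ltrDl.
pose D h : 'M[R]_m := h^-1 *: (Z (t + h) - Z t).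
(* By [Z^-1 - Z_h^-1 = Z_h^-1 (Z_h - Z) Z^-1], with [Z_h = Z (t + h)], this expression is exactly
   the difference quotient of the metric, so continuity of the inverse suffices. *)
have : ip ((1%:M - P) *m D h - P *m G0 *m invmx (Z (t + h)) *m D h *m invmx (Z t) *m G0)
   (evec R i) (evec R j) @[h --> H] -->
   ip ((1%:M - P) *m F (Z t) - P *m G0 *m invmx (Z t) *m F (Z t) *m invmx (Z t) *m G0)
   (evec R i) (evec R j).
  have cst (A : 'M[R]_m) k l : A k l @[_ --> H] --> A k l by exact: cvg_cst.
  have cD k l : D h k l @[h --> H] --> F (Z t) k l.
    rewrite (_ : (fun h => _) = fun h => h^-1 * (Z (t + h) k l - Z t k l))//.
    by apply/funext => h; rewrite !mxE.
  have cB (A B : R -> 'M[R]_m) (LA LB : 'M[R]_m) :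
      (forall k l, A h k l @[h --> H] --> LA k l) ->
      (forall k l, B h k l @[h --> H] --> LB k l) ->
      forall k l, (A h - B h) k l @[h --> H] --> (LA - LB) k l.
    move=> cA cB k l; rewrite !mxE; under eq_fun do rewrite !mxE.
    by apply: cvgB; [exact: cA|exact: cB].
  by apply: cvg_ip; apply: cB; repeat apply: cvg_mulmx.
apply: cvg_trans; apply: near_eq_cvg; near=> h.
have Kh : K (Z (t + h)) by apply: KZ; near: h.
have u1 := metric_unit (flow_domain_metric Kh).
have u0 := metric_unit (flow_domain_metric (KZ t t0)).
rewrite ip_evec.
have -> : (1%:M - P) *m D h
      - P *m G0 *m invmx (Z (t + h)) *m D h *m invmx (Z t) *m G0
  = h^-1 *: (G (Z (t + h)) - G (Z t)).
  rewrite /D -!(scalemxAr, scalemxAl) -scalerBr; congr (_ *: _).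
  have -> : P *m G0 *m invmx (Z (t + h)) *m (Z (t + h) - Z t) *m invmx (Z t) *m G0
      = P *m G0 *m invmx (Z t) *m G0 - P *m G0 *m invmx (Z (t + h)) *m G0.
    by rewrite mulmxBr !mulmxBl (mulmxKV u1) (mulmxK u0).
  by rewrite (mulmxBr (1%:M - P)) /flow_metric opprB opprD addrACA.
by rewrite !mxE.
Unshelve. all: by end_near. Qed.
End Flow.

Theorem theorem5p4 (R : realType) (m : nat) (c : 'I_m -> 'I_m -> 'rV[R]_m)
  (J G0 : 'M[R]_m) :
  lie_algebra c -> two_step_nilpotent c -> complex_structure c J ->
  J_preserves_commutators c J -> hermitian_metric J G0 ->
  exists G : R -> 'M[R]_m,
    G 0 = G0 /\
    (forall t : R, 0 <= t -> is_metric (G t)) /\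
    (forall t : R, 0 <= t -> forall i j : 'I_m,
       (fun h : R => h^-1 * (G (t + h) i j - G t i j)) @ (0 : R)^'+ -->
         - ricci11 c J (G t) (evec R i) (evec R j)) /\
    (forall t : R, 0 < t -> forall i j : 'I_m,
       is_derive t (1 : R) (fun s : R => G s i j)
         (- ricci11 c J (G t) (evec R i) (evec R j))).
Proof.
move=> [anti _] [nil _] [JJ _] Jc G0h.
have [P [PP cP Padk PG0 PJ]] := derived_projector nil JJ Jc G0h.
have [Z [Z0 Zt]] := flow_exists anti JJ G0h cP Padk PG0 PJ.
have KZ (s : R) : 0 <= s -> flow_domain J G0 P (Z s) by move=> /Zt[].
have G0u := metric_unit G0h.1.
exists (fun t => flow_metric G0 P (Z t)); split; [|split; [|split]].
- by rewrite Z0 /flow_metric -!mulmxA mulVmx// mulmx1 mulmxBl mul1mx subrK.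
- by move=> t t0; exact: flow_metric_metric G0h PP PG0 _ (KZ t t0).
- move=> t t0; apply: (flow_metric_cvg anti nil JJ G0h PP cP Padk PG0 PJ) => //.
  + by apply: within_subset => r /= r0; rewrite gt_eqF.
  + by near=> h; rewrite addr_ge0//; near: h; exact: nbhs_right_ge.
  + by have [] := Zt t t0.
- move=> t t0 i j; apply/is_deriveP.
  apply: (flow_metric_cvg anti nil JJ G0h PP cP Padk PG0 PJ) => //.
  + exact: ltW.
  + have ct : t + h @[h --> (0 : R)^'] --> t by exact: cvg_shift.
    by near=> h; apply/ltW; near: h; apply: (cvgr_gt t ct).
  + by have [] := Zt t (ltW t0).
Unshelve. all: by end_near. Qed.
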